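(* Let $n, m\geq 2$ and $r, s\geq 1$ be natural numbers. Then $G_{m,r}^+\cong G_{n,s}^+$ (as groups) if and only if $m=n$ and $\gcd(n-1,r)=\gcd(n-1,s)$.
   Context: Definition of the Higman-Thompson group $G_{n,r}$ ($n\ge 2$, $r\ge 1$). Let $\mathcal{A}_n=\{1,\dots,n\}$ be an alphabet, $X_r=\{\xi_1,\dots,\xi_r\}$ a set of $r$ elements disjoint from $\mathcal{A}_n$, and $W_n$ the free monoid on $\mathcal{A}_n$ (finite words, including the empty word). Let $X_rW_n$ be the set of words $\xi_i\alpha$ with $1\le i\le r$, $\alpha\in W_n$; $W_n$ acts on it by right concatenation. A subspace of $X_rW_n$ is a nonempty subset closed under right multiplication by elements of $W_n$. A subspace $V$ is cofinite if $X_rW_n\setminus V$ is finite. A homomorphism between subspaces is a map $\theta$ (written on the right) with $(uw)\theta=(u\theta)w$ for all $u$ in the domain and $w\in W_n$; an isomorphism is a bijective homomorphism; a cofinite isomorphism is an isomorphism $U\to V$ between cofinite subspaces $U,V$ of $X_rW_n$. An extension of a cofinite isomorphism $\theta$ is a cofinite isomorphism $\theta'$ agreeing with $\theta$ wherever $\theta$ is defined; a cofinite isomorphism is maximal if it has no nontrivial extension. Every cofinite isomorphism $\theta$ has a unique maximal extension $\theta^*$. $G_{n,r}$ is the set of maximal cofinite isomorphisms between subspaces of $X_rW_n$, with the following product: for $\phi_i:U_i\to V_i$ ($i=1,2$), put $S=V_1\cap U_2$, $R=S\phi_1^{-1}$, $T=S\phi_2$ (all cofinite); then $\phi_1\phi_2$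 is the maximal extension of the composite $R\to S\to T$ of $\phi_1|_R$ followed by $\phi_2|_S$. This is a group. $G_{n,r}^+$ denotes the commutator (derived) subgroup of $G_{n,r}$; its index in $G_{n,r}$ is $\gcd(n-1,2)$, so $G_{n,r}^+=G_{n,r}$ when $n$ is even. *)

(* Defs.v *)
From HB Require Import structures.
From mathcomp Require Import all_boot.
From mathcomp Require Import boolp classical_sets functions cardinality.

Set Implicit Arguments.
Unset Strict Implicit.
Unset Printing Implicit Defensive.

Local Open Scope classical_set_scope.

(* Quantifying over boolean predicates H covers all subgroups: logic is         *)
(* classical here.                                                            *)
Definition derived_pred (G : groupType) : {pred G} :=
  fun x => `[< forall H : {pred G}, group_closed H ->
                 (forall a b : G, [~ a, b]%g \in H) -> x \in H >].

Fact derived_group_closed (G : groupType) : group_closed (@derived_pred G).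
Proof.
split; first by apply/asboolP => H [].
move=> x y /asboolP xD /asboolP yD; apply/asboolP => H gH cH.
by case: (gH) => _; apply; [exact: xD | exact: yD].
Qed.

Definition derived (G : groupType) : Type := {x : G | derived_pred x}.

HB.instance Definition _ (G : groupType) :=
  [isSub of derived G for @sval G (@derived_pred G)].
HB.instance Definition _ (G : groupType) := [Choice of derived G by <:].
HB.instance Definition _ (G : groupType) :=
  SubChoice_isSubGroup.Build G (@derived_pred G) (derived G)
    (derived_group_closed G).

Definition group_isomorphic (G H : groupType) : Prop :=
  exists f : {multiplicative G -> H}, bijective f.

(* The pair (i, u) encodes the word xi_i u; indices and letters start at 0. *)
Definition xword (n r : nat) : Type := ('I_r * seq 'I_n)%type.

HB.instance Definition _ n r := Choice.on (xword n r).

Definition xact n r (x : xword n r) (w : seq 'I_n) : xword n r :=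
  (x.1, x.2 ++ w).

Definition subspace n r (V : set (xword n r)) : Prop :=
  V !=set0 /\ forall u w, V u -> V (xact u w).

(* A map between subsets of xword n r is a partial function: f x = None when x *)
(* is outside the domain. As the codomain is recovered as the image, two maps  *)
(* U -> V are equal iff the partial functions are.                             *)
Definition partial_map n r : Type := xword n r -> option (xword n r).

HB.instance Definition _ n r := Choice.on (partial_map n r).

Section PartialMaps.
Variables n r : nat.
Implicit Types f g : partial_map n r.

Definition pdom f : set (xword n r) := [set x | exists y, f x = Some y].
Definition pimg f : set (xword n r) := [set y | exists x, f x = Some y].

Record cofinite_iso f : Prop := CofiniteIso {
  ci_dom_subspace : subspace (pdom f);
  ci_dom_cofinite : cofinite_set (pdom f);
  ci_img_subspace : subspace (pimg f);
  ci_img_cofinite : cofinite_set (pimg f);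
  ci_inj : forall x x' y, f x = Some y -> f x' = Some y -> x = x';
  ci_hom : forall u y w, f u = Some y -> f (xact u w) = Some (xact y w)
}.

Definition extends g f : Prop := forall x y, f x = Some y -> g x = Some y.

Definition maximal_iso f : Prop :=
  cofinite_iso f /\ forall g, cofinite_iso g -> extends g f -> g = f.

(* The unique maximal extension of f, by maxextP and maxext_uniq below; the    *)
(* value is irrelevant when f is not a cofinite isomorphism.                   *)
Definition maxext f : partial_map n r := xget f [set g | maximal_iso g /\ extends g f].

(* f first, then g (maps act on the right); defined on (V1 `&` U2) f^-1. *)
Definition pcomp f g : partial_map n r := fun x => obind g (f x).

Definition pinv f : partial_map n r := fun y =>
  if pselect (exists x, f x = Some y) is left e then Some (sval (cid e))
  else None.

Lemma xact0 (x : xword n r) : xact x [::] = x.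
Proof. by case: x => i u; rewrite /xact /= cats0. Qed.

Lemma xactA (x : xword n r) v w : xact (xact x v) w = xact x (v ++ w).
Proof. by rewrite /xact /= catA. Qed.

Lemma xact_inj w : injective (fun x : xword n r => xact x w).
Proof.
move=> [i u] [j v]; rewrite /xact /= => -[-> e]; congr pair.
have su : size u = size v.
  by apply/eqP; rewrite -(eqn_add2r (size w)) -!size_cat e.
by move/eqP: e; rewrite eqseq_cat // => /andP[/eqP].
Qed.

Lemma pinvP f y x : cofinite_iso f -> pinv f y = Some x <-> f x = Some y.
Proof.
move=> cf; rewrite /pinv; case: pselect => [e|ne]; last first.
  by split=> // fx; case: ne; exists x.
case: (cid e) => z fz /=; split=> [[<-]//|fx].
by congr Some; exact: (ci_inj cf fz fx).
Qed.

Lemma pinv_iso f : cofinite_iso f -> cofinite_iso (pinv f).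
Proof.
move=> cf.
have Ed : pdom (pinv f) = pimg f.
  by apply/seteqP; split=> y [x]; exists x; apply/(pinvP _ _ cf).
have Ei : pimg (pinv f) = pdom f.
  by apply/seteqP; split=> y [x]; exists x; apply/(pinvP _ _ cf).
split; rewrite ?Ed ?Ei; try by case: cf.
- move=> x x' y /(pinvP _ _ cf) fx /(pinvP _ _ cf).
  by rewrite fx => -[].
- move=> u y w /(pinvP _ _ cf) fu; apply/(pinvP _ _ cf).
  exact: ci_hom.
Qed.

Lemma extends_refl f : extends f f.
Proof. by []. Qed.

Lemma extends_trans f g h : extends h g -> extends g f -> extends h f.
Proof. by move=> hg gf x y /gf /hg. Qed.

Lemma pcomp_extends f f' g g' :
  extends f' f -> extends g' g -> extends (pcomp f' g') (pcomp f g).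
Proof.
by move=> ef eg x z; rewrite /pcomp; case E: (f x) => [y|//] /= /eg; rewrite (ef _ _ E).
Qed.

Lemma pcompP f g x z :
  pcomp f g x = Some z <-> exists2 y, f x = Some y & g y = Some z.
Proof.
rewrite /pcomp; split; last by case=> y -> /=.
by case: (f x) => [y|//] /= gy; exists y.
Qed.

Lemma pcompA f g h : pcomp f (pcomp g h) = pcomp (pcomp f g) h.
Proof. by apply/funext => x; rewrite /pcomp; case: (f x). Qed.

Lemma pcomp_pinv f : cofinite_iso f -> extends Some (pcomp f (pinv f)).
Proof.
move=> cf x z /pcompP[y fx /(pinvP _ _ cf) fz].
by congr Some; exact: (ci_inj cf fx fz).
Qed.

Lemma pinv_pcomp f : cofinite_iso f -> extends Some (pcomp (pinv f) f).
Proof. by move=> cf x z /pcompP[y /(pinvP _ _ cf) -> ]. Qed.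

Hypothesis n_ge2 : 2 <= n.

Let a0 : 'I_n := Ordinal (ltnW n_ge2).

Lemma cofinite_reach (V : set (xword n r)) (x : xword n r) :
  cofinite_set V -> exists w, V (xact x w).
Proof.
move=> cV; apply: contrapT => nV; apply: infinite_nat.
pose f k := xact x (nseq k a0).
have := @finite_preimage _ _ _ f _ cV.
rewrite (_ : f @^-1` _ = setT); last first.
  by apply/seteqP; split=> // k _ Vk; apply: nV; exists (nseq k a0).
apply=> i j _ _ [] /(congr1 size).
by rewrite !size_cat !size_nseq => /addnI.
Qed.

Lemma subspace_reach2 (U V : set (xword n r)) (x x' : xword n r) :
  subspace U -> cofinite_set U -> cofinite_set V ->
  exists w, U (xact x w) /\ V (xact x' w).
Proof.
move=> [_ sU] cU cV; have [w Uw] := cofinite_reach x cU.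
have [v Vv] := cofinite_reach (xact x' w) cV.
by exists (w ++ v); rewrite -!xactA; split=> //; apply: sU.
Qed.

Lemma pcomp_iso f g : cofinite_iso f -> cofinite_iso g ->
  cofinite_iso (pcomp f g).
Proof.
move=> cf cg.
have [[[x0 _] _] sg] := (ci_dom_subspace cf, ci_dom_subspace cg).
have [w [[y fy]]] := @subspace_reach2 _ _ x0 x0 (ci_img_subspace cf)
  (ci_img_cofinite cf) (ci_dom_cofinite cg).
move=> [z gz].
have hom u t v : pcomp f g u = Some t -> pcomp f g (xact u v) = Some (xact t v).
  move=> /pcompP[s fu gs]; apply/pcompP; exists (xact s v); exact: ci_hom.
split=> //.
- split; first by exists y, z; apply/pcompP; exists (xact x0 w).
  by move=> u v [t /hom ut]; exists (xact t v).
- have fin : finite_set (~` pdom f `|` (fun t => odflt t (pinv f t)) @` ~` pdom g).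
    rewrite finite_setU; split; first exact: ci_dom_cofinite.
    exact/finite_image/ci_dom_cofinite.
  apply: sub_finite_set fin => u nu.
  have [[t fu]|] := pselect (pdom f u); last by left.
  right; exists t; last by rewrite (proj2 (pinvP _ _ cf) fu).
  by move=> [v gt]; apply: nu; exists v; apply/pcompP; exists t.
- split; first by exists z, y; apply/pcompP; exists (xact x0 w).
  by move=> u v [t /hom ut]; exists (xact t v).
- have fin : finite_set (~` pimg g `|` (fun t => odflt t (g t)) @` ~` pimg f).
    rewrite finite_setU; split; first exact: ci_img_cofinite.
    exact/finite_image/ci_img_cofinite.
  apply: sub_finite_set fin => u nu.
  have [[t gt]|] := pselect (pimg g u); last by left.
  right; exists t; last by rewrite gt.
  by move=> [v fv]; apply: nu; exists v; apply/pcompP; exists t.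
- move=> x x' v /pcompP[s fx gs] /pcompP[s' fx' gs'].
  have E := ci_inj cg gs gs'; rewrite -E in fx'.
  exact: (ci_inj cf fx fx').
Qed.

Lemma maxext_exists f : cofinite_iso f ->
  exists g, [/\ cofinite_iso g, extends g f &
    forall h, cofinite_iso h -> extends h f -> extends g h].
Proof.
move=> cf; have [sU cU] := (ci_dom_subspace cf, ci_dom_cofinite cf).
pose P x y := forall w z, f (xact x w) = Some z -> z = xact y w.
have Puniq x y y' : P x y -> P x y' -> y = y'.
  move=> Pxy Pxy'; have [w [z fz]] := cofinite_reach x cU.
  by apply: (@xact_inj w); rewrite /= -(Pxy _ _ fz) -(Pxy' _ _ fz).
pose g : partial_map n r := fun x =>
  if pselect (exists y, P x y) is left e then Some (sval (cid e)) else None.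
have gP x y : g x = Some y <-> P x y.
  rewrite /g; case: pselect => [e|ne]; last by split=> // Pxy; case: ne; exists y.
  by case: (cid e) => z Pz /=; split=> [[<-]//|/(Puniq _ _ _ Pz) ->].
have gf : extends g f.
  by move=> x y fx; apply/gP => w z; rewrite (ci_hom cf w fx) => -[].
have ghom u y w : g u = Some y -> g (xact u w) = Some (xact y w).
  by move=> /gP Pu; apply/gP => v z; rewrite !xactA; apply: Pu.
exists g; split=> //.
- split=> //.
  + split; last by move=> u w [y /ghom gy]; exists (xact y w).
    by have [[x [y /gf fx]] _] := sU; exists x, y.
  + apply: sub_finite_set cU => x; apply: contra_not => -[y /gf gy].
    by exists y.
  + have [[y [x /gf fx]] _] := ci_img_subspace cf.
    split; first by exists y, x.
    by move=> u w [t /ghom gt]; exists (xact t w).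
  + apply: sub_finite_set (ci_img_cofinite cf) => x; apply: contra_not.
    by move=> -[y /gf gy]; exists y.
  + move=> x x' y /gP Px /gP Px'.
    have [w [[z fz] [z' fz']]] := subspace_reach2 x x' sU cU cU.
    apply: (@xact_inj w); apply: (ci_inj cf fz).
    by rewrite fz' (Px _ _ fz) (Px' _ _ fz').
- move=> h ch hf x y hx; apply/gP => w z /hf.
  by rewrite (ci_hom ch w hx) => -[].
Qed.

Lemma extends_anti f g : extends f g -> extends g f -> f = g.
Proof.
move=> fg gf; apply/funext => x.
case E: (g x) => [y|]; first exact: fg.
by case E': (f x) => [y|//]; rewrite (gf _ _ E') in E.
Qed.

Lemma maxext_uniq f g h : cofinite_iso f ->
  maximal_iso g -> extends g f -> maximal_iso h -> extends h f -> g = h.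
Proof.
move=> /maxext_exists[k [ck kf kP]] [cg mg] gf [ch mh] hf.
by rewrite -(mg _ ck (kP _ cg gf)) -(mh _ ck (kP _ ch hf)).
Qed.

Lemma maxextP f : cofinite_iso f -> maximal_iso (maxext f) /\ extends (maxext f) f.
Proof.
move=> /maxext_exists[g [cg gf gP]].
apply: (@xgetPex _ f [set g | maximal_iso g /\ extends g f]).
exists g; split=> //; split=> // h ch hg.
by apply: extends_anti => //; apply: gP => //; apply: extends_trans gf.
Qed.

Lemma maxext_iso f : cofinite_iso f -> cofinite_iso (maxext f).
Proof. by case/maxextP=> -[]. Qed.

Lemma maxext_eq f g : cofinite_iso f -> maximal_iso g -> extends g f ->
  maxext f = g.
Proof. by move=> cf mg gf; have [] := maxextP cf => ? ?; exact: (maxext_uniq cf). Qed.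

Lemma maxext_id f : maximal_iso f -> maxext f = f.
Proof. by move=> mf; apply: maxext_eq => //; case: mf. Qed.

Lemma maxext_extends f g : cofinite_iso f -> cofinite_iso g -> extends g f ->
  maxext f = maxext g.
Proof.
move=> cf cg gf; have [mg eg] := maxextP cg.
by apply: maxext_eq => //; apply: extends_trans gf.
Qed.

Hypothesis r_ge1 : 1 <= r.

Lemma Some_maximal : maximal_iso (Some : partial_map n r).
Proof.
have dE : pdom Some = setT by apply/seteqP; split=> // x _; exists x.
have iE : pimg Some = setT by apply/seteqP; split=> // x _; exists x.
have sT : subspace [set: xword n r].
  by split=> //; exists (Ordinal r_ge1, [::]).
split; last by move=> g _ gS; apply/funext => x; rewrite (gS x x).
by split; rewrite ?dE ?iE ?setCT //; move=> *; congruence.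
Qed.

End PartialMaps.

Definition higman_thompson n r (n_ge2 : 2 <= n) (r_ge1 : 1 <= r) : Type :=
  {f : partial_map n r | `[< maximal_iso f >]}.

Section HigmanThompsonGroup.
Variables (n r : nat) (n_ge2 : 2 <= n) (r_ge1 : 1 <= r).
Local Notation G := (higman_thompson n_ge2 r_ge1).

HB.instance Definition _ := [isSub of G for @sval _ _].
HB.instance Definition _ := [Choice of G by <:].

Implicit Types x y z : G.

Fact ht_maximal x : maximal_iso (val x).
Proof. exact/asboolP/(valP x). Qed.

Fact ht_iso x : cofinite_iso (val x).
Proof. by case: (ht_maximal x). Qed.

Fact ht_maxext_subproof (f : partial_map n r) :
  cofinite_iso f -> `[< maximal_iso (maxext f) >].
Proof. by move=> /(maxextP n_ge2)[mf _]; apply/asboolP. Qed.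

Definition ht_mul x y : G :=
  Sub (maxext (pcomp (val x) (val y)))
    (ht_maxext_subproof (pcomp_iso n_ge2 (ht_iso x) (ht_iso y))).

Definition ht_one : G := Sub Some (asboolT (Some_maximal n r_ge1)).

Definition ht_inv x : G :=
  Sub (maxext (pinv (val x))) (ht_maxext_subproof (pinv_iso (ht_iso x))).

Fact ht_mulA : associative ht_mul.
Proof.
move=> x y z; apply/val_inj => /=.
have [[cx cy] cz] := (ht_iso x, ht_iso y, ht_iso z).
have cxy := pcomp_iso n_ge2 cx cy; have cyz := pcomp_iso n_ge2 cy cz.
have [mxy exy] := maxextP n_ge2 cxy; have [myz eyz] := maxextP n_ge2 cyz.
transitivity (maxext (pcomp (val x) (pcomp (val y) (val z)))).
  symmetry; apply: maxext_extends => //; try exact: pcomp_iso.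
    by apply: pcomp_iso => //; case: myz.
  exact: pcomp_extends.
rewrite pcompA; apply: maxext_extends => //; try exact: pcomp_iso.
  by apply: pcomp_iso => //; case: mxy.
exact: pcomp_extends.
Qed.

Fact ht_mul1 : left_id ht_one ht_mul.
Proof.
by move=> x; apply/val_inj => /=; exact: (maxext_id n_ge2 (ht_maximal x)).
Qed.

Fact ht_mulr1 : right_id ht_one ht_mul.
Proof.
move=> x; apply/val_inj => /=; rewrite (_ : pcomp _ _ = val x).
  exact: (maxext_id n_ge2 (ht_maximal x)).
by apply/funext => u; rewrite /pcomp /=; case: (sval x u).
Qed.

Fact ht_mulV : left_inverse ht_one ht_inv ht_mul.
Proof.
move=> x; apply/val_inj => /=; have cx := ht_iso x; have cv := pinv_iso cx.
have [[cm _] em] := maxextP n_ge2 cv.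
rewrite -(@maxext_extends _ _ n_ge2 (pcomp (pinv (val x)) (val x))) //.
- apply: (maxext_eq n_ge2); [exact: pcomp_iso|exact: Some_maximal|].
  exact: pinv_pcomp.
- exact: pcomp_iso.
- exact: pcomp_iso.
- exact: pcomp_extends.
Qed.

Fact ht_mulrV : right_inverse ht_one ht_inv ht_mul.
Proof.
move=> x; apply/val_inj => /=; have cx := ht_iso x; have cv := pinv_iso cx.
have [[cm _] em] := maxextP n_ge2 cv.
rewrite -(@maxext_extends _ _ n_ge2 (pcomp (val x) (pinv (val x)))) //.
- apply: (maxext_eq n_ge2); [exact: pcomp_iso|exact: Some_maximal|].
  exact: pcomp_pinv.
- exact: pcomp_iso.
- exact: pcomp_iso.
- exact: pcomp_extends.
Qed.

HB.instance Definition _ :=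
  isGroup.Build G ht_mulA ht_mul1 ht_mulr1 ht_mulV ht_mulrV.

End HigmanThompsonGroup.

(* Main.v *)
Require Import Defs.
From HB Require Import structures.
From mathcomp Require Import all_boot.
From mathcomp Require Import boolp classical_sets cardinality zify.

Set Implicit Arguments.
Unset Strict Implicit.
Unset Printing Implicit Defensive.

(** Let the group G(n,r) act on the points (i, z), where i < r and z is an
    infinite word; its elements are exactly the piecewise prefix replacements.

    Necessity. By Rubin's trick, disjointness of supports is almost a first-order
    property of the derived group, so the centralizer of
    [{g^12 | g is algebraically disjoint from all of F}], for F finite, consists
    of the elements supported in the closure of the union of the supports of F.
    These closures are exactly the clopen sets, hence an isomorphism of derived
    groups induces an isomorphism of the Boolean algebras of clopen sets which
    respects orbits. Two proper nonempty clopen sets are in the same orbit iff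
    they are unions of numbers of cones that agree modulo n-1. Therefore n-1
    divides k iff every proper nonempty clopen set splits into k+1 members of
    its own orbit, and a divisor t of n-1 divides r iff the whole space splits
    into t clopen sets of one orbit.

    Sufficiency. G(n,r) is the automorphism group of a Jonsson-Tarski algebra
    (a bijection Y = Y^n) that is free on r generators. A free algebra on r
    generators is also free on r+n-1 generators. If d is prime to n-1, the
    structures consisting of a Jonsson-Tarski algebra X and a bijection Y = X^d
    turn out to be interdefinable with Jonsson-Tarski algebras on Y: both are
    systems X = X^A * Y^P, Y = X^B * Y^D, and one passes from one to the other
    by substituting one equation into the other and by changing X, following
    the Euclidean algorithm. So the d-th power of the free algebra on d*r
    generators is free on r generators, with the same automorphisms, that is,
    G(n,d*r) = G(n,r). *)

(** * The action on infinite words *)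

Local Notation pcomp := Defs.pcomp.

Local Notation pinv := Defs.pinv.

Definition iword n : Type := nat -> 'I_n.
Definition point n r : Type := ('I_r * iword n)%type.

(** The default value of [nth] depends on [i]: past the end of [w] it is the letter of [z] at the
    shifted position, so the default carries the infinite tail. *)
Definition app n (w : seq 'I_n) (z : iword n) : iword n :=
  fun i => nth (z (i - size w)) w i.
Definition ev n r (u : xword n r) (z : iword n) : point n r := (u.1, app u.2 z).
Definition pref n r k (x : point n r) : xword n r := (x.1, mkseq x.2 k).
Definition tl n r k (x : point n r) : iword n := fun i => x.2 (k + i).
Definition cone n r (u : xword n r) (x : point n r) : Prop := exists z, x = ev u z.

Section Words.
Variables n r : nat.
Implicit Types (u v : xword n r) (w : seq 'I_n) (z : iword n) (x : point n r).

Lemma app_cat w w' z : app (w ++ w') z = app w (app w' z).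
Proof.
apply/funext => i; rewrite /app nth_cat size_cat; case: ltnP => h.
  exact: set_nth_default.
by rewrite (nth_default _ h) subnDA.
Qed.

Lemma app0 z : app [::] z = z.
Proof. by apply/funext => i; rewrite /app subn0 nth_nil. Qed.

Lemma app_inj w : injective (app w).
Proof.
move=> z z' /funeqP e; apply/funext => i; move: (e (size w + i)).
by rewrite /app !nth_default ?leq_addr // addKn.
Qed.

Lemma app_size_inj w w' z z' : size w = size w' -> app w z = app w' z' ->
  w = w' /\ z = z'.
Proof.
move=> es e; suff ew : w = w' by split=> //; apply: (@app_inj w); rewrite e ew.
apply: (@eq_from_nth _ (z 0)) => // i iw.
move/funeqP: e => /(_ i); rewrite /app.
rewrite (set_nth_default (z 0)) // => ->.
by rewrite (set_nth_default (z 0)) // -es.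
Qed.

Lemma app_size_leq w w' z z' : size w <= size w' -> app w z = app w' z' ->
  exists w'', w' = w ++ w'' /\ z = app w'' z'.
Proof.
move=> es; rewrite -{1}(cat_take_drop (size w) w') app_cat.
move=> /app_size_inj[|ew ez]; first by rewrite size_takel.
by exists (drop (size w) w'); rewrite {1}ew cat_take_drop.
Qed.

Lemma ev_act u w z : ev (xact u w) z = ev u (app w z).
Proof. by rewrite /ev /= app_cat. Qed.

Lemma ev_inj u : injective (ev u).
Proof. by move=> z z' [] /app_inj. Qed.

Lemma ev_size_leq u v z z' : size u.2 <= size v.2 -> ev u z = ev v z' ->
  exists w, v = xact u w /\ z = app w z'.
Proof.
move=> es [e1] /(app_size_leq es)[w [e2 e3]]; exists w; split=> //.
by rewrite /xact e1 -e2; case: v {es e1 e2}.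
Qed.

Lemma ev_pref k x : ev (pref k x) (tl k x) = x.
Proof.
case: x => i z; congr pair; apply/funext => j.
rewrite /app /= size_mkseq; case: (ltnP j k) => h; first by rewrite nth_mkseq.
by rewrite nth_default ?size_mkseq // /tl /= subnKC.
Qed.

Lemma size_pref k x : size (pref k x).2 = k.
Proof. exact: size_mkseq. Qed.

Lemma pref_ev u z : pref (size u.2) (ev u z) = u.
Proof.
case: u => i w; rewrite /pref /ev /=; congr pair.
apply: (@eq_from_nth _ (z 0)); rewrite ?size_mkseq // => j jw.
by rewrite nth_mkseq // /app; apply: set_nth_default.
Qed.

Lemma pref_ext k l x : k <= l ->
  pref l x = xact (pref k x) (mkseq (fun i => x.2 (k + i)) (l - k)).
Proof.
move=> kl; congr pair; rewrite /= /mkseq -{1}(subnKC kl) iotaD map_cat.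
congr cat; rewrite add0n -[X in iota X]addn0 iotaDl -map_comp.
by apply: eq_map => i.
Qed.

Lemma cone_pref k x : cone (pref k x) x.
Proof. by exists (tl k x); rewrite ev_pref. Qed.

Lemma cone_ev u z : cone u (ev u z). Proof. by exists z. Qed.
Hint Resolve cone_ev : core.

Lemma cone_act u w x : cone (xact u w) x -> cone u x.
Proof. by case=> z ->; rewrite ev_act. Qed.

Lemma cone_prefP u x : cone u x <-> pref (size u.2) x = u.
Proof.
split=> [[z ->]|<-]; first exact: pref_ev.
exact: cone_pref.
Qed.

Hypothesis n2 : 2 <= n.

Definition letter (i : bool) : 'I_n :=
  if i then Ordinal n2 else Ordinal (ltnW n2).

Lemma other_letter (a : 'I_n) : exists b : 'I_n, b != a.
Proof.
have [->|ne] := eqVneq a (letter true); first by exists (letter false).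
by exists (letter true); rewrite eq_sym.
Qed.

(** The shorter word is a prefix of the longer one. If a letter [a] followed, the constant word on a
    letter other than [a] would tell the two apart; this uses n >= 2. *)
Lemma ev_sep u v : (forall z, ev u z = ev v z) -> u = v.
Proof.
have H u' v' : size u'.2 <= size v'.2 -> (forall z, ev u' z = ev v' z) -> u' = v'.
  move=> es e; have [w [ew _]] := ev_size_leq es (e (fun=> letter true)).
  case: w ew => [|a w] ew; first by rewrite ew xact0.
  have [b ba] := other_letter a; have := e (fun=> b).
  rewrite ew ev_act => /ev_inj /funeqP /(_ 0) /= eb.
  by move: ba; rewrite eb eqxx.
move=> e; case: (leqP (size u.2) (size v.2)) => h; first exact: H.
by symmetry; apply: H => //; exact: ltnW.
Qed.

End Words.

#[export] Hint Resolve cone_ev cone_pref : core.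

Section Action.
Variables n r : nat.
Hypotheses (n2 : 2 <= n) (r1 : 1 <= r).
Implicit Types (u v : xword n r) (w : seq 'I_n) (z : iword n) (x : point n r).

(* Piecewise prefix replacement, with a uniform bound on the length of the     *)
(* replaced prefixes, which spares compactness arguments.                      *)
Definition pw_at q (N : nat) (h : point n q -> point n r) : Prop :=
  forall x : point n q, exists (u : xword n q) (v : xword n r),
    [/\ size u.2 <= N, cone u x &
      forall z, h (ev u z) = ev v z].
Definition pw q (h : point n q -> point n r) : Prop := exists N, pw_at N h.

(** Take the prefix given at any one point of the cone of [u]: it is not longer than [u], so its
    replacement rule governs the whole cone. *)
Lemma pw_atP q N (h : point n q -> point n r) : pw_at N h ->
  forall u : xword n q, N <= size u.2 ->
  exists v : xword n r, forall z, h (ev u z) = ev v z.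
Proof.
move=> ph u Nu; have [u' [v' [su [z0 e] e']]] := ph (ev u (fun=> letter n2 true)).
have [|w [-> _]] := @ev_size_leq _ _ u' u z0 _ _ (esym e).
  exact: leq_trans Nu.
by exists (xact v' w) => z; rewrite !ev_act e'.
Qed.

Lemma cofinite_bound (V : set (xword n r)) : cofinite_set V ->
  exists N, forall u, N <= size u.2 -> V u.
Proof.
move=> /finite_seqP[s es]; exists (\max_(u <- s) size u.2).+1 => u hu.
apply: contrapT => nV; have : u \in s.
  have : (~` V)%classic u by [].
  by rewrite es.
move=> /(@leq_bigmax_seq _ _ xpredT (fun u => size u.2)) /(_ isT).
by rewrite leqNgt hu.
Qed.

Lemma iso_ex (f : partial_map n r) x : cofinite_iso f ->
  exists y, exists u v z, [/\ f u = Some v, x = ev u z & y = ev v z].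
Proof.
move=> cf; have [N hN] := cofinite_bound (ci_dom_cofinite cf).
have [|v fv] := hN (pref N x); first by rewrite size_pref.
by exists (ev v (tl N x)), (pref N x), v, (tl N x); rewrite ev_pref.
Qed.

Definition act_pm (f : partial_map n r) x : point n r :=
  xget x [set y | exists u v z, [/\ f u = Some v, x = ev u z & y = ev v z]].

(** Of two prefixes of one point, one extends the other, so [ci_hom] makes the image independent of
    the prefix chosen by [xget]. *)
Lemma act_pmE f u v z : cofinite_iso f -> f u = Some v ->
  act_pm f (ev u z) = ev v z.
Proof.
move=> cf fu; rewrite /act_pm; case: xgetP => [y -> [u' [v' [z' [fu' e ->]]]]|].
  case: (leqP (size u.2) (size u'.2)) => h.
    have [w [eu ez]] := ev_size_leq h e; subst u' z.
    by rewrite (ci_hom cf w fu) in fu'; case: fu' => <-; rewrite ev_act.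
  have [w [eu ez]] := ev_size_leq (ltnW h) (esym e); subst u z'.
  by rewrite (ci_hom cf w fu') in fu; case: fu => <-; rewrite ev_act.
by move=> /(_ (ev v z)) []; exists u, v, z.
Qed.

Lemma act_pm_ext f g : cofinite_iso f -> cofinite_iso g -> extends g f ->
  act_pm g = act_pm f.
Proof.
move=> cf cg gf; apply/funext => x.
have [_ [u [v [z [fu -> _]]]]] := iso_ex x cf.
by rewrite (act_pmE _ cf fu) (act_pmE _ cg (gf _ _ fu)).
Qed.

Lemma act_pm_comp f g : cofinite_iso f -> cofinite_iso g ->
  act_pm (pcomp f g) =1 act_pm g \o act_pm f.
Proof.
move=> cf cg x; have cfg := pcomp_iso n2 cf cg.
have [_ [u [v [z [fu -> _]]]]] := iso_ex x cfg.
rewrite (act_pmE _ cfg fu); move/pcompP: fu => [y fu gy] /=.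
by rewrite (act_pmE _ cf fu) (act_pmE _ cg gy).
Qed.

Lemma act_pm_pw f : cofinite_iso f -> pw (act_pm f).
Proof.
move=> cf; have [N hN] := cofinite_bound (ci_dom_cofinite cf).
exists N => x; have [|v fv] := hN (pref N x); first by rewrite size_pref.
exists (pref N x), v; split=> //; first by rewrite size_pref.
by move=> z; rewrite (act_pmE _ cf fv).
Qed.

(** This map has the largest domain among those inducing [h], which is why it is a maximal
    isomorphism ([pm_of_max]). *)
Definition pm_of (h : point n r -> point n r) : partial_map n r := fun u =>
  if pselect (exists v, forall z, h (ev u z) = ev v z) is left e
  then Some (sval (cid e)) else None.

Lemma pm_ofP h u v : pm_of h u = Some v <-> forall z, h (ev u z) = ev v z.
Proof.
rewrite /pm_of; case: pselect => [e|ne]; last first.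
  by split=> // e; case: ne; exists v.
case: (cid e) => v' e' /=; split=> [[<-]//|e''].
by congr Some; apply: (ev_sep n2) => z; rewrite -e' e''.
Qed.

Lemma cofinite_long (V : set (xword n r)) N : (forall u, N <= size u.2 -> V u) ->
  cofinite_set V.
Proof.
move=> h; apply: (@sub_finite_set _ _
  [set` [seq (i, w) | i <- enum 'I_r, w <- flatten [seq [seq val t | t : k.-tuple 'I_n] | k <- iota 0 N]]]).
  move=> [i w] nV /=; apply: allpairs_f; first exact: mem_enum.
  apply/flatten_mapP; exists (size w).
    rewrite mem_iota add0n /=; rewrite ltnNge; apply/negP => Nw; exact/nV/h.
  by rewrite -[w]/(val (in_tuple w)); apply: map_f; rewrite mem_enum.
exact: finite_seq.
Qed.

Lemma pm_of_iso h g : cancel h g -> cancel g h -> pw h -> pw g ->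
  cofinite_iso (pm_of h).
Proof.
have dsub k : pw k -> subspace (pdom (pm_of k)) /\ cofinite_set (pdom (pm_of k)).
  move=> [N pk]; have long u : N <= size u.2 -> pdom (pm_of k) u.
    by move=> /(pw_atP pk)[v e]; exists v; apply/pm_ofP.
  split; last exact: (cofinite_long long).
  split; last first.
    move=> u w [v /pm_ofP e]; exists (xact v w); apply/pm_ofP => z.
    by rewrite !ev_act e.
  exists (Ordinal r1, nseq N (letter n2 true)); apply: long.
  by rewrite size_nseq.
move=> hK gK ph pg.
have Ei : pimg (pm_of h) = pdom (pm_of g).
  apply/seteqP; split=> v [u /pm_ofP e]; exists u; apply/pm_ofP => z.
    by rewrite -e hK.
  by rewrite -e gK.
have [] := (dsub _ ph, dsub _ pg); move=> [d1 d2] [d3 d4].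
split; rewrite ?Ei //.
- move=> u u' v /pm_ofP e /pm_ofP e'; apply: (ev_sep n2) => z.
  by apply: (can_inj hK); rewrite e e'.
- move=> u v w /pm_ofP e; apply/pm_ofP => z; by rewrite !ev_act e.
Qed.

Lemma act_pm_of h g : cancel h g -> cancel g h -> pw h -> pw g ->
  act_pm (pm_of h) = h.
Proof.
move=> hK gK ph pg; have cf := pm_of_iso hK gK ph pg.
apply/funext => x; have [_ [u [v [z [fu -> _]]]]] := iso_ex x cf.
by rewrite (act_pmE _ cf fu); move/pm_ofP: fu.
Qed.

Lemma pm_of_max h g : cancel h g -> cancel g h -> pw h -> pw g ->
  maximal_iso (pm_of h).
Proof.
move=> hK gK ph pg; have cf := pm_of_iso hK gK ph pg; split=> // k ck ek.
apply: extends_anti => // u v ku; apply/pm_ofP => z.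
by rewrite -(act_pmE _ ck ku) (act_pm_ext cf ck ek) (act_pm_of hK gK).
Qed.

(** The map [pm_of (act_pm f)] is a cofinite isomorphism extending [f], so it equals [f] by
    maximality. Hence a group element is determined by its action. *)
Lemma maximal_pm_of f : maximal_iso f -> forall u v,
  f u = Some v <-> forall z, act_pm f (ev u z) = ev v z.
Proof.
move=> [cf mf]; have ci := pinv_iso cf.
have K1 : cancel (act_pm f) (act_pm (pinv f)).
  move=> x; have := act_pm_comp cf ci x; rewrite /= => <-.
  have [_ [u [v [z [fu -> _]]]]] := iso_ex x (pcomp_iso n2 cf ci).
  rewrite (act_pmE _ (pcomp_iso n2 cf ci) fu).
  by case: (pcomp_pinv cf fu) => ->.
have K2 : cancel (act_pm (pinv f)) (act_pm f).
  move=> x; have := act_pm_comp ci cf x; rewrite /= => <-.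
  have [_ [u [v [z [fu -> _]]]]] := iso_ex x (pcomp_iso n2 ci cf).
  rewrite (act_pmE _ (pcomp_iso n2 ci cf) fu).
  by case: (pinv_pcomp cf fu) => ->.
have cm := pm_of_iso K1 K2 (act_pm_pw cf) (act_pm_pw ci).
suff E : pm_of (act_pm f) = f by move=> u v; rewrite -{1}E; exact: pm_ofP.
by apply: mf => // u v fu; apply/pm_ofP => z; exact: act_pmE.
Qed.

Local Notation G := (higman_thompson n2 r1).

Definition rho (g : G) : point n r -> point n r := act_pm (val g).

Lemma rhoM (g h : G) : rho (g * h)%g =1 rho h \o rho g.
Proof.
move=> x; have [cg ch] := (ht_iso g, ht_iso h).
rewrite -[RHS](act_pm_comp cg ch); congr (_ x).
have cgh := pcomp_iso n2 cg ch; have [[cm _] em] := maxextP n2 cgh.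
exact: act_pm_ext.
Qed.

Lemma rho1 : rho 1%g =1 id.
Proof.
move=> x; rewrite -{1}(ev_pref 0 x) /rho.
by rewrite (@act_pmE _ _ (pref 0 x)) ?ev_pref //; exact: (ht_iso (1%g : G)).
Qed.

Lemma rho_inj (g h : G) : rho g =1 rho h -> g = h.
Proof.
move=> e; apply/val_inj/funext => u.
have [Hg Hh] := (maximal_pm_of (ht_maximal g), maximal_pm_of (ht_maximal h)).
have H : forall v, val g u = Some v <-> val h u = Some v.
  by move=> v; rewrite Hg Hh; split=> E z; rewrite -E; [exact/esym/e|exact: e].
case E: (val g u) => [v|]; first by symmetry; apply/H.
by case E': (val h u) => [v|//]; move/H: E'; rewrite E.
Qed.

Lemma rhoK (g : G) : cancel (rho g) (rho g^-1%g).
Proof. by move=> x; have := rhoM g g^-1%g x; rewrite mulgV rho1. Qed.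

Lemma rho_pw (g : G) : pw (rho g).
Proof. exact/act_pm_pw/ht_iso. Qed.

(** Together with [rhoM] and [rho_inj], this identifies the group with the bijections of points that
    are piecewise prefix replacements in both directions. *)
Lemma rho_surj h h' : cancel h h' -> cancel h' h -> pw h -> pw h' ->
  exists g : G, rho g = h.
Proof.
move=> hK h'K ph ph'; have mf := pm_of_max hK h'K ph ph'.
exists (Sub (pm_of h) (asboolT mf)); exact: (act_pm_of hK h'K).
Qed.

End Action.

(** * Rubin's reconstruction of supports *)

(** An algebraic approximation to disjointness of supports: disjoint supports imply it, and it
    implies that [g ^+ 12] fixes every point moved by [f]. *)
Definition alg_disjoint (H : groupType) (f g : H) : Prop :=
  forall h : H, [~ f, h]%g <> 1%g -> exists f1 f2 : H,
    [/\ commute f1 g, commute f2 g, commute [~ f1, [~ f2, h]]%g g &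
        [~ f1, [~ f2, h]]%g <> 1%g].

(** The exponent 12 is the least common multiple of 1, 2, 3 and 4: a point moved by [g ^+ 12] is
    moved by each of the first four powers of [g]. *)
Definition disj_centralizer (H : groupType) (F : seq H) (u : H) : Prop :=
  forall g, (forall f, f \in F -> alg_disjoint f g) -> commute u (g ^+ 12)%g.

Section Transport.
Variables (H K : groupType) (phi : {multiplicative H -> K}) (psi : K -> H).
Hypotheses (phiK : cancel phi psi) (psiK : cancel psi phi).

Let phi1 : phi 1%g = 1%g.
Proof. by apply: (@mulgI _ (phi 1%g)); rewrite -gmulfM !mulg1. Qed.

Let phi_eq1 x : (phi x = 1%g) = (x = 1%g).
Proof. by apply/propext; split=> [|-> //]; rewrite -{1}phi1 => /(can_inj phiK). Qed.

Let phiV x : phi x^-1%g = (phi x)^-1%g.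
Proof. by apply: (@mulgI _ (phi x)); rewrite -gmulfM !mulgV. Qed.

Let phiR x y : phi [~ x, y]%g = [~ phi x, phi y]%g.
Proof. by rewrite !gmulfM !phiV. Qed.

Let phiX x k : phi (x ^+ k)%g = (phi x ^+ k)%g.
Proof. by elim: k => [|k IH]; rewrite ?expg0 // !expgS gmulfM IH. Qed.

Lemma commute_iso x y : commute (phi x) (phi y) = commute x y.
Proof. by apply/propext; rewrite /commute -!gmulfM; split=> [/(can_inj phiK)|->]. Qed.

Lemma alg_disjoint_iso f g : alg_disjoint (phi f) (phi g) <-> alg_disjoint f g.
Proof.
split=> D h.
  move=> fh; have [|f1 [f2 []]] := D (phi h); first by rewrite -phiR phi_eq1.
  rewrite -(psiK f1) -(psiK f2) -!phiR !commute_iso phi_eq1 => *.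
  by exists (psi f1), (psi f2).
rewrite -(psiK h) -phiR phi_eq1 => /D[f1 [f2 []]].
by exists (phi f1), (phi f2); rewrite -!phiR !commute_iso phi_eq1.
Qed.

Lemma disj_centralizer_iso F u :
  disj_centralizer (map phi F) (phi u) <-> disj_centralizer F u.
Proof.
split=> Z g Fg.
  rewrite -commute_iso phiX; apply: Z => _ /mapP[f fF ->].
  by apply/alg_disjoint_iso/Fg.
rewrite -(psiK g) -phiX commute_iso; apply: Z => f fF.
by rewrite -alg_disjoint_iso psiK; apply: Fg; rewrite map_f.
Qed.

End Transport.

(* [a] is a right action; the sets [cone w] play the role of a basis of open   *)
(* sets, but no topology is needed.                                           *)
Section Rubin.
Variables (H : groupType) (Om : Type) (a : H -> Om -> Om).
Hypotheses (aM : forall g h x, a (g * h)%g x = a h (a g x))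
           (a1 : forall x, a 1%g x = x)
           (a_inj : forall g h, (forall x, a g x = a h x) -> g = h).

Definition supported (A : Om -> Prop) (g : H) : Prop :=
  forall x, ~ A x -> a g x = x.
Definition translate (g : H) (A : Om -> Prop) (x : Om) : Prop := A (a g^-1%g x).

Lemma aK g x : a g^-1%g (a g x) = x.
Proof. by rewrite -aM mulgV a1. Qed.

Lemma aVK g x : a g (a g^-1%g x) = x.
Proof. by rewrite -aM mulVg a1. Qed.

Lemma a_injr g : injective (a g).
Proof. exact: can_inj (aK g). Qed.

Lemma aV_fix g x : a g x = x -> a g^-1%g x = x.
Proof. by move=> e; rewrite -{1}e aK. Qed.

Lemma aX_fix g x k : a g x = x -> a (g ^+ k)%g x = x.
Proof. by move=> e; elim: k => [|k IH]; rewrite ?expg0 ?a1 // expgS aM e. Qed.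

Lemma neq1_moves g : g <> 1%g -> exists x, a g x <> x.
Proof.
move=> g1; apply: contrapT => nx; apply: g1; apply: a_inj => x; rewrite a1.
by apply: contrapT => gx; apply: nx; exists x.
Qed.

Lemma aR g h x : a [~ g, h]%g x = a h (a g (a h^-1%g (a g^-1%g x))).
Proof. by rewrite /commg /conjg !aM. Qed.

Lemma supportedM A g h : supported A g -> supported A h -> supported A (g * h)%g.
Proof. by move=> Ag Ah x nx; rewrite aM Ag // Ah. Qed.

Lemma supportedV A g : supported A g -> supported A g^-1%g.
Proof. by move=> Ag x /Ag /aV_fix. Qed.

Lemma supportedX A g k : supported A g -> supported A (g ^+ k)%g.
Proof. by move=> Ag x /Ag /aX_fix. Qed.

Lemma supported_sub (A B : Om -> Prop) g :
  (forall x, A x -> B x) -> supported A g -> supported B g.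
Proof. by move=> AB Ag x nB; apply: Ag => /AB. Qed.

Lemma supported_stable A g x : supported A g -> A x -> A (a g x).
Proof.
move=> Ag Ax; apply: contrapT => nA; have e := Ag _ nA.
by apply: nA; rewrite (a_injr e).
Qed.

Lemma disjoint_commute A g h : supported A g -> (forall x, A x -> a h x = x) ->
  commute g h.
Proof.
move=> Ag Ah; apply: a_inj => x; rewrite !aM.
have [Ax|nx] := pselect (A x).
  by rewrite (Ah _ Ax) Ah //; exact: supported_stable.
rewrite (Ag _ nx) Ag // => Ahx; apply: nx.
by have := Ah _ Ahx => /a_injr e; rewrite e in Ahx.
Qed.

Lemma supported_conj A g u : supported (translate g A) u <->
  supported A (u ^ g^-1)%g.
Proof.
rewrite /conjg invgK; split=> S x nx.
  by rewrite !aM S /translate ?aK.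
have := S (a g^-1%g x) nx; rewrite !aM aVK => e.
by apply: (@a_injr g^-1%g).
Qed.

Variables (W : Type) (cone : W -> Om -> Prop).
Hypothesis cone_ex : forall x, exists w, cone w x.
Hypothesis shrink : forall g w x, cone w x -> a g x <> x ->
  exists w', [/\ cone w' x, forall y, cone w' y -> cone w y &
    forall y, cone w' y -> ~ cone w' (a g y)].
Hypothesis cone_nonabelian : forall w, exists g h,
  [/\ supported (cone w) g, supported (cone w) h & ~ commute g h].
Hypothesis cone_power : forall w, exists g,
  supported (cone w) g /\ (g ^+ 12)%g <> 1%g.

Lemma cone_neq1 w : exists2 g, supported (cone w) g & g <> 1%g.
Proof.
have [g [sg g12]] := cone_power w; exists g => // g1; apply: g12.
by rewrite g1 expg1n.
Qed.

Lemma shrink_ex g x : a g x <> x -> exists w, [/\ cone w x,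
  forall y, cone w y -> a g y <> y & forall y, cone w y -> ~ cone w (a g y)].
Proof.
have [w0 wx0] := cone_ex x.
move=> gx; have [w [wx _ d]] := shrink wx0 gx; exists w; split=> // y wy e.
by apply: (d _ wy); rewrite e.
Qed.

(** As [f] and [h] do not commute, some [x] is moved by both. Near [x] there is a cone [v] all moved
    by [f], hence fixed by [g], and disjoint from its image under [h]. For noncommuting [f1], [f2]
    supported in [v], the double commutator collapses to [[~ f1, f2^-1]], which is nontrivial and
    supported in [v]. *)
Lemma disjoint_alg_disjoint f g : (forall x, a f x <> x -> a g x = x) ->
  alg_disjoint f g.
Proof.
move=> dfg h fh.
have [x fx hx] : exists2 x, a f x <> x & a h x <> x.
  apply: contrapT => nx; apply: fh; apply/eqP/commgP.
  apply: (@disjoint_commute (fun x => a f x <> x)).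
    by move=> x; exact: contrapT.
  by move=> x fx; apply: contrapT => hx; apply: nx; exists x.
have [w [wx wf _]] := shrink_ex fx.
have [v [vx vw vh]] := shrink wx hx.
have [f1 [f2 [s1 s2 nc]]] := cone_nonabelian v.
have cg k : supported (cone v) k -> commute k g.
  by move=> sk; apply: (disjoint_commute sk) => y /vw /wf /dfg.
(* [~ f2, h] is f2^-1 on the cone v, and off v it moves only points of a h v *)
pose c := [~ f2, h]%g.
have onv y : cone v y -> a c y = a f2^-1%g y.
  move=> vy; rewrite /c aR; set y' := a f2^-1%g y.
  have vy' : cone v y' by apply: supported_stable vy; exact: supportedV.
  rewrite [a f2 _]s2 ?aVK // => vh'; apply: (vh _ vh').
  by rewrite aVK.
have kE : [~ f1, c]%g = [~ f1, f2^-1]%g.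
  have fix1 y : ~ cone v y -> a f1 y = y /\ a f1^-1%g y = y.
    by move=> ny; split; [exact: s1|exact: supportedV ny].
  have cst y : cone v y -> cone v (a c y).
    by move=> vy; rewrite onv //; apply: supported_stable vy; exact: supportedV.
  have cVonv y : cone v y -> a c^-1%g y = a f2 y.
    move=> vy; apply: (@a_injr c); rewrite aVK onv ?aK //.
    exact: supported_stable.
  have cV y : ~ cone v y -> ~ cone v (a c^-1%g y).
    by move=> ny /cst; rewrite aVK.
  apply: a_inj => y; have [vy|ny] := pselect (cone v y).
    rewrite (aR f1 c) (aR f1 f2^-1%g) invgK.
    have vy1 : cone v (a f1^-1%g y) by apply: supported_stable vy; exact: supportedV.
    rewrite cVonv // onv //; apply: supported_stable => //.
    exact: supported_stable.
  rewrite [RHS](_ : _ = y); last first.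
    rewrite aR invgK (fix1 _ ny).2 (s2 _ ny) (fix1 _ ny).1.
    by rewrite (supportedV s2 ny).
  rewrite (aR f1 c) (fix1 _ ny).2 (fix1 _ (cV _ ny)).1 aVK //.
have sk : supported (cone v) [~ f1, f2^-1]%g.
  by rewrite /commg /conjg; do !apply: supportedM => //; do ?exact: supportedV; rewrite invgK.
exists f1, f2; rewrite -/c kE; split; try exact: cg.
move=> /eqP /commgP; move=> /commuteV; rewrite invgK; exact: nc.
Qed.

Lemma shrink_many (F : seq H) w x : cone w x -> (forall g, g \in F -> a g x <> x) ->
  exists w', [/\ cone w' x, forall y, cone w' y -> cone w y &
    forall g y, g \in F -> cone w' y -> ~ cone w' (a g y)].
Proof.
elim: F w => [|g F IH] w wx Fx; first by exists w; split.
have [|v [vx vw vF]] := IH w wx; first by move=> h hF; apply: Fx; rewrite inE hF orbT.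
have [|v' [vx' vv vg]] := shrink vx (g := g); first by apply: Fx; rewrite inE eqxx.
exists v'; split=> // [y /vv /vw //|h y].
rewrite inE => /orP[/eqP-> /vg //|hF vy /vv]; exact: vF (vv _ vy).
Qed.

(* If g^12 moves x, then x, ..., g^4 x are distinct, so they have disjoint     *)
(* neighbourhoods g^i w. The support of k = [~ f1, [~ f2, h]], with h supported *)
(* in w, is covered by four translates of w by elements commuting with g; but  *)
(* it is g-invariant, so two of the five points g^i z of it lie in the same    *)
(* translate.                                                                  *)
Lemma alg_disjoint_disjoint f g : alg_disjoint f g ->
  forall x, a f x <> x -> a (g ^+ 12)%g x = x.
Proof.
move=> D x fx; apply: contrapT => gx.
have gk k : k %| 12 -> a (g ^+ k)%g x <> x.
  by move=> /dvdnP[q e] gx'; apply: gx; rewrite e mulnC expgnA; exact: aX_fix.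
have [w0 wx0] := cone_ex x.
have [|w [wx _ wF]] := @shrink_many [:: f; g; g ^+ 2; g ^+ 3; g ^+ 4]%g w0 x wx0.
  move=> k; rewrite !inE => /or4P[/eqP->|/eqP->|/eqP->|/orP[]/eqP->] //;
  try exact: gk; by rewrite -(expg1 g); exact: gk.
have [h sh h1] := cone_neq1 w.
have [y hy] := neq1_moves h1.
have wy : cone w y by apply: contrapT => /sh.
have [|f1 [f2 [c1 c2 ck k1]]] := D h.
  move=> /eqP/commgP c; apply: (wF f y _ wy); first by rewrite !inE eqxx.
  (* h moves y, so it moves a f y, which is off w *)
  apply: contrapT => nfy; apply: hy.
  apply: (@a_injr f); rewrite -aM -c aM; exact: sh.
set k := [~ f1, [~ f2, h]]%g in ck k1.
(* The support of [[~ f2, h]] lies in [w] and its image under [f2]; that of [k] lies in these two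
   sets and their images under [f1]. Each [T i] brings one of the four translates back to [w]. *)
pose T (i : 'I_4) := nth 1%g [:: 1; f2^-1; f1^-1; f1^-1 * f2^-1]%g i.
have cT i : commute (T i) g.
  have [c1' c2'] : commute f1^-1%g g /\ commute f2^-1%g g.
    by split; apply/commute_sym/commuteV/commute_sym.
  rewrite /T; case: i => -[|[|[|[|//]]]] _ //=.
    exact/commute_sym/commute1.
  by apply/commute_sym/commuteM; apply/commute_sym.
have fixc x' : ~ cone w x' -> ~ cone w (a f2^-1%g x') -> a [~ f2, h]%g x' = x'.
  move=> n1 n2; rewrite aR (supportedV sh n2) aVK; exact: sh.
have Tk x' : a k x' <> x' -> exists i, cone w (a (T i) x').
  move=> kx; apply: contrapT => nT; apply: kx.
  have nw i : ~ cone w (a (T i) x') by move=> wi; apply: nT; exists i.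
  have := (nw (inord 0), nw (inord 1), nw (inord 2), nw (inord 3)).
  rewrite /T !inordK //= a1 aM => -[[[n1 n2] n3] n4].
  by rewrite /k aR (aV_fix (fixc _ n3 n4)) aVK; exact: fixc.
have [z kz] := neq1_moves k1.
have kgz i : a k (a (g ^+ i)%g z) <> a (g ^+ i)%g z.
  rewrite -aM; have -> : (g ^+ i * k = k * g ^+ i)%g by apply/esym/commuteX.
  rewrite aM => /a_injr; exact: kz.
have [t tP] := choice (fun i : 'I_5 => Tk _ (kgz i)).
have : ~ injective t by move=> /leq_card; rewrite !card_ord.
have main i j : t i = t j -> i < j -> False.
  move=> et lt; have := tP j; rewrite -et.
  have -> : a (T (t i)) (a (g ^+ j)%g z) =
            a (g ^+ (j - i))%g (a (T (t i)) (a (g ^+ i)%g z)).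
    rewrite -!aM; congr (a _ z).
    rewrite -?mulgA (commuteX (j - i) (cT (t i))) mulgA -expgnDr.
    by rewrite subnKC // ltnW.
  apply: wF (tP i); have := ltn_ord j; rewrite ltnS => j4.
  have : j - i <= 4 by apply: leq_trans (leq_subr _ _) j4.
  have : 0 < j - i by rewrite subn_gt0.
  by case: (j - i) => [|[|[|[|[|//]]]]] //=; rewrite !inE ?expg1 eqxx ?orbT.
apply => i j tij; apply: val_inj => /=.
by case: (ltngtP i j) => // [/(main _ _ tij)|/(main _ _ (esym tij))].
Qed.

(** The closure of the union of the supports of the elements of [F]. *)
Definition closed_support (F : seq H) (x : Om) : Prop :=
  forall w, cone w x -> exists f y, [/\ f \in F, cone w y & a f y <> y].

(** If [u] moves a point off the closure, a small cone [v] there misses the supports of [F] and its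
    own image under [u]; some [g] supported in [v] with nontrivial 12th power is disjoint from [F],
    but [u] does not commute with that power. Conversely, an admissible [g ^+ 12] fixes the closure
    pointwise, since a cone that it moves entirely would meet the support of some member of [F]. *)
Lemma disj_centralizerP F u :
  disj_centralizer F u <-> supported (closed_support F) u.
Proof.
split=> [Z x nx|S g Fg].
  apply: contrapT => ux; apply: nx => w wx; apply: contrapT => nf.
  have [v [vx vw vu]] := shrink wx ux.
  have [g [sg g12]] := cone_power v.
  have : commute u (g ^+ 12)%g.
    apply: Z => f fF; apply: disjoint_alg_disjoint => y fy.
    apply: sg => /vw wy; apply: nf; by exists f, y.
  have [y gy] := neq1_moves g12; have s12 := supportedX 12 sg.
  have vy : cone v y by apply: contrapT => /s12.
  move=> cu; apply: gy; apply: (@a_injr u).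
  by rewrite -aM -cu aM; apply: s12; exact: vu.
apply: (disjoint_commute S) => x Cx; apply: contrapT => gx.
have [w [wx wg _]] := shrink_ex gx.
have [f [y [fF wy fy]]] := Cx _ wx.
exact: wg _ wy (alg_disjoint_disjoint (Fg _ fF) fy).
Qed.

End Rubin.

(** * Clopen sets and three-cycles of cones *)

Section ConeLemmas.
Variables n r : nat.
Implicit Types (u v : xword n r) (x y : point n r).

Definition disj u v := forall x, cone u x -> ~ cone v x.

Lemma disj_sym u v : disj u v -> disj v u.
Proof. by move=> d x vx ux; exact: d ux vx. Qed.

Lemma disj_ext u w w' : size w = size w' -> w <> w' -> disj (xact u w) (xact u w').
Proof.
move=> es ne x [z ->] [z']; rewrite !ev_act => /ev_inj /app_size_inj [] //.
Qed.

Lemma pref_eq j u x y : j <= size u.2 -> cone u x -> cone u y ->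
  pref j x = pref j y.
Proof.
move=> ju /cone_prefP xu /cone_prefP yu.
have E : pref (size u.2) x = pref (size u.2) y by rewrite xu yu.
case: x E {xu} => i z; case: y {yu} => i' z' [-> e]; congr pair.
apply: (@eq_from_nth _ (z 0)); rewrite ?size_mkseq // => k kj.
rewrite !nth_mkseq //; have := congr1 (fun s => nth (z 0) s k) e.
by rewrite !nth_mkseq // (leq_trans kj ju).
Qed.

Lemma pref_neq x y : x <> y -> exists j, pref j x <> pref j y.
Proof.
case: x y => i z [i' z'] ne; apply: contrapT => nj; apply: ne.
have e j : pref j (i, z) = pref j (i', z').
  by apply: contrapT => ?; apply: nj; exists j.
have /(congr1 fst) /= <- := e 0; congr pair; apply/funext => k.
have /(congr1 (fun t => nth (z 0) t.2 k)) := e k.+1.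
by rewrite !nth_mkseq.
Qed.

Definition words k : seq (xword n r) :=
  [seq (i, val t) | i <- enum 'I_r, t <- enum {: k.-tuple 'I_n}].

Lemma mem_words k u : (u \in words k) = (size u.2 == k).
Proof.
apply/idP/eqP => [/allpairsP[[i t] [_ _ ->]]|]; first exact: size_tuple.
case: u => i w /= sw; have tw : size w == k by rewrite sw.
by apply/allpairsP; exists (i, Tuple tw); rewrite !mem_enum.
Qed.

Lemma words_uniq k : uniq (words k).
Proof.
apply: allpairs_uniq; try exact: enum_uniq.
by move=> [i t] [j t'] _ _ [-> /val_inj ->].
Qed.

Lemma size_words k : size (words k) = r * n ^ k.
Proof. by rewrite size_allpairs -!cardE card_ord card_tuple card_ord. Qed.

(** Membership depends on a prefix of bounded length. By compactness of the space of points these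
    are the topologically clopen sets, and the bound spares that argument. *)
Definition clopen (A : point n r -> Prop) : Prop :=
  exists N, forall x y, pref N x = pref N y -> A x -> A y.

Lemma clopen_level A N M : (forall x y, pref N x = pref N y -> A x -> A y) ->
  N <= M -> forall x y, pref M x = pref M y -> A x -> A y.
Proof.
move=> AN NM x y e; apply: AN; apply: (@pref_eq _ (pref M x)) => //.
  by rewrite size_pref.
by rewrite e.
Qed.

Lemma clopen_cone A x : clopen A -> A x -> exists k, forall y, cone (pref k x) y -> A y.
Proof.
move=> [N AN] Ax; exists N => y /cone_prefP e; apply: AN Ax.
by rewrite -e size_pref.
Qed.

Lemma cone_clopen u : clopen (cone u).
Proof.
exists (size u.2) => x y e /cone_prefP xu.
by apply/cone_prefP; rewrite -e.
Qed.

Lemma clopenC A : clopen A -> clopen (fun x => ~ A x).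
Proof. by move=> [N AN]; exists N => x y e nx Ay; apply: nx; exact: AN Ay. Qed.

Lemma clopenU (I : finType) (B : I -> point n r -> Prop) :
  (forall i, clopen (B i)) -> clopen (fun x => exists i, B i x).
Proof.
move=> /choice[N BN]; exists (\max_i N i) => x y e [i Bx]; exists i.
by apply: (clopen_level (BN i) _ e) Bx; exact: leq_bigmax.
Qed.

Lemma clopenI A B : clopen A -> clopen B -> clopen (fun x => A x /\ B x).
Proof.
move=> [N AN] [M BM]; exists (maxn N M) => x y e [Ax Bx]; split.
  by apply: (clopen_level AN _ e) Ax; rewrite leq_maxl.
by apply: (clopen_level BM _ e) Bx; rewrite leq_maxr.
Qed.

End ConeLemmas.

Section Elements.
Variables (n r : nat) (n2 : 2 <= n) (r1 : 1 <= r).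
Local Notation G := (higman_thompson n2 r1).
Local Notation D := (derived (higman_thompson n2 r1)).
Implicit Types (u v w : xword n r) (x y : point n r) (g h : D).

Definition act g : point n r -> point n r := rho (val g).

Lemma actM g h x : act (g * h)%g x = act h (act g x).
Proof. exact: rhoM. Qed.

Lemma act1 x : act 1%g x = x.
Proof. exact: rho1. Qed.

Lemma act_inj g h : (forall x, act g x = act h x) -> g = h.
Proof. by move=> e; apply/val_inj/rho_inj. Qed.

Definition swap u v x : point n r :=
  if pref (size u.2) x == u then ev v (tl (size u.2) x)
  else if pref (size v.2) x == v then ev u (tl (size v.2) x) else x.

Lemma tl_ev u z : tl (size u.2) (ev u z) = z.
Proof.
apply/funext => i; rewrite /tl /ev /app /= nth_default ?leq_addr //.
by rewrite addKn.
Qed.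

Lemma swapl u v z : swap u v (ev u z) = ev v z.
Proof. by rewrite /swap pref_ev eqxx tl_ev. Qed.

Lemma swapr u v z : disj u v -> swap u v (ev v z) = ev u z.
Proof.
move=> d; rewrite /swap pref_ev eqxx tl_ev; case: eqP => // /cone_prefP /d.
by case.
Qed.

Lemma swap_out u v x : ~ cone u x -> ~ cone v x -> swap u v x = x.
Proof. by move=> nu nv; rewrite /swap; do 2![case: eqP => [/cone_prefP//|_]]. Qed.

Lemma swapK u v : disj u v -> involutive (swap u v).
Proof.
move=> d x; have [[z ->]|nu] := pselect (cone u x); first by rewrite swapl swapr.
have [[z ->]|nv] := pselect (cone v x); first by rewrite swapr // swapl.
by rewrite !swap_out.
Qed.

Lemma swap_pw u v : disj u v -> pw (swap u v).
Proof.
move=> d; exists (size u.2 + size v.2) => x.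
have [ux|nu] := pselect (cone u x).
  by exists u, v; rewrite leq_addr; split=> // z; rewrite swapl.
have [vx|nv] := pselect (cone v x).
  by exists v, u; rewrite leq_addl; split=> // z; rewrite swapr.
exists (pref (size u.2 + size v.2) x), (pref (size u.2 + size v.2) x).
rewrite size_pref; split=> // z.
have H t : size t.2 <= size u.2 + size v.2 -> ~ cone t x ->
    ~ cone t (ev (pref (size u.2 + size v.2) x) z).
  move=> st nt ct; apply: nt; apply/cone_prefP; move/cone_prefP: ct => {2}<-.
  by apply: (@pref_eq _ _ _ (pref (size u.2 + size v.2) x)); rewrite ?size_pref.
by rewrite swap_out //; apply: H; rewrite // ?leq_addr ?leq_addl.
Qed.

Lemma swap_ex u v : disj u v -> exists g : G, rho g = swap u v.
Proof.
move=> d; apply: (@rho_surj _ _ n2 r1 (swap u v) (swap u v)); try exact: swapK.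
all: exact: swap_pw.
Qed.

Lemma derived_comm (a b : G) : exists g : D, val g = [~ a, b]%g.
Proof.
have d : derived_pred [~ a, b]%g by apply/asboolP => K _; apply.
by exists (Sub [~ a, b]%g d); rewrite SubK.
Qed.

(** The commutator of the transpositions [swap u v] and [swap v w] is a 3-cycle of cones. This is
    the only source of elements of the derived group, which need not be described further. *)
Lemma three_cycle u v w : disj u v -> disj v w -> disj u w -> exists g,
  [/\ forall z, act g (ev u z) = ev v z, forall z, act g (ev v z) = ev w z,
      forall z, act g (ev w z) = ev u z &
      forall x, ~ cone u x -> ~ cone v x -> ~ cone w x -> act g x = x].
Proof.
move=> uv vw uw; have [[a ea] [b eb]] := (swap_ex uv, swap_ex vw).
have [g eg] := derived_comm a b; exists g.
have aV x : rho a^-1%g x = swap u v x.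
  by rewrite -[RHS](rhoK a) ea swapK.
have bV x : rho b^-1%g x = swap v w x.
  by rewrite -[RHS](rhoK b) eb swapK.
have E x : act g x = swap v w (swap u v (swap v w (swap u v x))).
  have M (k l : G) y : rho (k * l)%g y = rho l (rho k y) by exact: rhoM.
  by rewrite /act eg /commg /conjg !M aV bV ea eb.
have o1 z : swap v w (ev u z) = ev u z.
  by apply: swap_out; [exact: uv|exact: uw].
have o2 z : swap u v (ev w z) = ev w z.
  by apply: swap_out => ?; [apply: (disj_sym uw)|apply: (disj_sym vw)]; eauto.
split=> [z|z|z|x nu nv nw]; rewrite E.
- by rewrite swapl swapl o2 swapr.
- by rewrite swapr // o1 swapl swapl.
- by rewrite o2 swapr // swapr // o1.
- by rewrite [swap u v x]swap_out // [swap v w x]swap_out // [swap u v x]swap_out // swap_out.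
Qed.

Lemma act_level g : exists N, forall u, N <= size u.2 ->
  exists v, forall z, act g (ev u z) = ev v z.
Proof. by have [N gN] := rho_pw (val g); exists N; exact: pw_atP. Qed.

Lemma act_shrink g w x : cone w x -> act g x <> x ->
  exists w', [/\ cone w' x, forall y, cone w' y -> cone w y &
    forall y, cone w' y -> ~ cone w' (act g y)].
Proof.
move=> wx gx; have [N gN] := act_level g.
have [j xj] := pref_neq gx.
(* Prefixes of length [k] stay inside [w] and are replaced by [g]. The [j] further letters separate
   [x] from its image and make the image prefix [xact v t] long enough to be compared at length
   [j]. *)
pose k := N + size w.2.
have [|v gv] := gN (pref k x); first by rewrite size_pref leq_addr.
have jk : k <= k + j by rewrite leq_addr.
set t := mkseq (fun i => x.2 (k + i)) (k + j - k).
have et : pref (k + j) x = xact (pref k x) t by exact: pref_ext.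
have st : size t = j by rewrite size_mkseq addKn.
exists (pref (k + j) x); split=> // [y yw|y [z ey] yw].
  apply/cone_prefP; move/cone_prefP: (wx) => {2}<-.
  apply: (@pref_eq _ _ _ (pref (k + j) x)) => //.
  by rewrite size_pref -addnA addnCA leq_addr.
apply: xj; rewrite -(@pref_eq _ _ _ (pref (k + j) x) _ _ _ yw (cone_pref _ _)); last first.
  by rewrite size_pref leq_addl.
apply: (@pref_eq _ _ _ (xact v t)); first by rewrite size_cat st leq_addl.
  by rewrite -{1}(ev_pref (k + j) x) et ev_act gv -ev_act.
by rewrite ey et ev_act gv -ev_act.
Qed.

Definition wd (b c d : bool) : seq 'I_n := [:: letter n2 b; letter n2 c; letter n2 d].

Lemma letter_inj : injective (letter n2).
Proof. by move=> [] [] // /(congr1 val). Qed.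

Lemma wd_disj u b c d b' c' d' : (b, c, d) <> (b', c', d') ->
  disj (xact u (wd b c d)) (xact u (wd b' c' d')).
Proof.
by move=> ne; apply: disj_ext => // -[] /letter_inj e1 /letter_inj e2 /letter_inj e3;
  apply: ne; rewrite e1 e2 e3.
Qed.

(** Two 3-cycles sharing exactly one cone, on five of the eight subcones given by three binary
    letters. They do not commute, and their product is a 5-cycle, whose 12th power is nontrivial. *)
Lemma two_cycles u : exists g h (w : bool -> bool -> bool -> xword n r),
  [/\ supported act (cone u) g, supported act (cone u) h,
    [/\ forall z, act g (ev (w true true true) z) = ev (w true true false) z,
        forall z, act g (ev (w true true false) z) = ev (w true false true) z &
        forall z, act g (ev (w true false true) z) = ev (w true true true) z],
    [/\ forall z, act h (ev (w true false true) z) = ev (w false true true) z,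
        forall z, act h (ev (w false true true) z) = ev (w false false true) z &
        forall z, act h (ev (w false false true) z) = ev (w true false true) z] &
    [/\ forall z, act g (ev (w false true true) z) = ev (w false true true) z,
        forall z, act g (ev (w false false true) z) = ev (w false false true) z,
        forall z, act h (ev (w true true true) z) = ev (w true true true) z,
        forall z, act h (ev (w true true false) z) = ev (w true true false) z &
    forall b c d b' c' d', (b, c, d) <> (b', c', d') -> disj (w b c d) (w b' c' d')]].
Proof.
pose w b c d := xact u (wd b c d).
have dw b c d b' c' d' : (b, c, d) <> (b', c', d') -> disj (w b c d) (w b' c' d').
  exact: wd_disj.
have [|||g [g1 g2 g3 go]] := @three_cycle (w true true true) (w true true false) (w true false true);
  try exact: dw.
have [|||h [h1 h2 h3 ho]] := @three_cycle (w true false true) (w false true true) (w false false true);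
  try exact: dw.
exists g, h, w; split=> //.
- by move=> x nu; apply: go => /cone_act.
- by move=> x nu; apply: ho => /cone_act.
split=> // z; first [apply: go|apply: ho]; by apply: dw (cone_ev _ _).
Qed.

Lemma cone_noncomm u : exists g h,
  [/\ supported act (cone u) g, supported act (cone u) h & ~ commute g h].
Proof.
have [g [h [w [sg sh [g1 g2 g3] [h1 h2 h3] [g4 g5 h4 h5 dw]]]]] := two_cycles u.
exists g, h; split=> // c; pose z : iword n := fun=> letter n2 true.
have := actM g h (ev (w true true false) z); rewrite c actM.
rewrite h5 g2 h1; apply/eqP/negP => /eqP e.
by apply: (@dw true false true false true true _ (ev (w true false true) z)) => //; rewrite e.
Qed.

Lemma cone_pow12 u : exists g, supported act (cone u) g /\ (g ^+ 12)%g <> 1%g.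
Proof.
have [g [h [w [sg sh [g1 g2 g3] [h1 h2 h3] [g4 g5 h4 h5 dw]]]]] := two_cycles u.
exists (g * h)%g; split; first exact: (supportedM actM).
pose z : iword n := fun=> letter n2 true.
have f1 : act (g * h)%g (ev (w true true true) z) = ev (w true true false) z by rewrite actM g1.
have f2 : act (g * h)%g (ev (w true true false) z) = ev (w false true true) z by rewrite actM g2 h1.
have f3 : act (g * h)%g (ev (w false true true) z) = ev (w false false true) z by rewrite actM g4 h2.
have f4 : act (g * h)%g (ev (w false false true) z) = ev (w true false true) z by rewrite actM g5 h3.
have f5 : act (g * h)%g (ev (w true false true) z) = ev (w true true true) z by rewrite actM g3 h4.
move: (g * h)%g f1 f2 f3 f4 f5 => k f1 f2 f3 f4 f5 e.
have := act1 (ev (w true true true) z); rewrite -e !expgS !actM expg0 act1.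
(* Twelve steps go twice around the 5-cycle and then two cones further. *)
rewrite f1 f2 f3 f4 f5 f1 f2 f3 f4 f5 f1 f2 => e'.
by apply: (@dw true true true false true true _ (ev (w true true true) z)) => //; rewrite -e'.
Qed.

End Elements.

(** * Reconstruction of the clopen sets *)

Section Clopens.
Variables (n r : nat) (n2 : 2 <= n) (r1 : 1 <= r).
Local Notation D := (derived (higman_thompson n2 r1)).
Local Notation act := (@act n r n2 r1).
Local Notation supported := (supported act).
Local Notation closed_support := (closed_support act (@cone n r)).
Implicit Types (u v w : xword n r) (x y : point n r) (g h : D).
Implicit Types A B : point n r -> Prop.

Let cone_ex x : exists w, cone w x.
Proof. by exists (pref 0 x). Qed.

Lemma disj_centralizer_supp (F : seq D) g :
  disj_centralizer F g <-> supported (closed_support F) g.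
Proof.
apply: disj_centralizerP; first exact: actM.
- exact: act1.
- exact: act_inj.
- exact: cone_ex.
- exact: act_shrink.
- exact: cone_noncomm.
- exact: cone_pow12.
Qed.

Lemma cone_neq u : exists2 g, supported (cone u) g & g <> 1%g.
Proof. exact: (cone_neq1 (@cone_pow12 _ _ n2 r1)). Qed.

Lemma act_neq1 g : g <> 1%g -> exists x, act g x <> x.
Proof. exact: (neq1_moves (@act1 _ _ n2 r1) (@act_inj _ _ n2 r1)). Qed.

(** At a common level [N] every member of [F] replaces prefixes. If one of them moves a point of a
    cone of that level, it changes the prefix, so by [ev_sep] it moves a point of each smaller cone:
    the whole cone lies in the closure. *)
Lemma closed_support_clopen (F : seq D) : clopen (closed_support F).
Proof.
have [N FN] : exists N, forall g, g \in F -> forall u, N <= size u.2 ->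
    exists v, forall z, act g (ev u z) = ev v z.
  elim: F => [|g F [N FN]]; first by exists 0.
  have [M gM] := act_level g; exists (maxn M N) => h; rewrite inE.
  move=> /orP[/eqP->|/FN hN] u; rewrite geq_max => /andP[Mu Nu]; first exact: gM.
  exact: hN.
exists N => x y exy Ex w wy; apply: contrapT => nf.
have [|f [x' [fF ux' fx']]] := Ex (pref N x); first exact: cone_pref.
have [|v fv] := FN f fF (pref N x); first by rewrite size_pref.
have NM : N <= maxn N (size w.2) by exact: leq_maxl.
set t := mkseq (fun i => y.2 (N + i)) (maxn N (size w.2) - N).
have et : pref (maxn N (size w.2)) y = xact (pref N x) t by rewrite exy; exact: pref_ext.
have : xact v t = xact (pref N x) t.
  apply: (ev_sep n2) => z; rewrite !ev_act -fv -ev_act.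
  apply: contrapT => ne; apply: nf; exists f, (ev (xact (pref N x) t) z); split=> //.
  rewrite -et; apply/cone_prefP; have /cone_prefP ew := wy; rewrite -[RHS]ew.
  by apply: (@pref_eq _ _ _ (pref (maxn N (size w.2)) y)); rewrite ?size_pref ?leq_maxr.
move=> /(@xact_inj _ _ t) ev'; apply: fx'.
by case: ux' => z ->; rewrite fv ev'.
Qed.

(** A 3-cycle through the cone around [x] that is two letters deeper. Two letters give at least four
    subcones, so two others are available even for n = 2. *)
Lemma move_off N x : exists g, supported (cone (pref N x)) g /\
  forall y, cone (pref N.+2 x) y -> act g y <> y.
Proof.
pose l b c : seq 'I_n := [:: letter n2 b; letter n2 c].
have l_inj b c b' c' : l b c = l b' c' -> b = b' /\ c = c'.
  by move=> [] /letter_inj -> /letter_inj ->.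
set t := mkseq (fun i => x.2 (N + i)) (N.+2 - N).
have et : pref N.+2 x = xact (pref N x) t.
  by apply: pref_ext; rewrite -addn2 leq_addr.
have st : size t = 2 by rewrite size_mkseq -addn2 addKn.
clearbody t.
have [t1 [t2 [s1 s2 [n1 n2' n3]]]] : exists t1 t2 : seq 'I_n,
    [/\ size t1 = 2, size t2 = 2 & [/\ t <> t1, t1 <> t2 & t <> t2]].
  have [e1|e1] := pselect (t = l true true).
    exists (l true false), (l false false); split=> //; split; rewrite ?e1;
    by move=> /l_inj[].
  have [e2|e2] := pselect (t = l true false).
    exists (l true true), (l false false); split=> //; split; rewrite ?e2;
    by move=> /l_inj[].
  exists (l true true), (l true false); split=> //; split=> //.
have [|||g [g1 _ _ go]] := @three_cycle _ _ n2 r1 (xact (pref N x) t)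
  (xact (pref N x) t1) (xact (pref N x) t2); try by apply: disj_ext; congruence.
exists g; split=> [y ny|y]; first by apply: go => /cone_act.
rewrite et => -[z ->]; rewrite g1 => e.
have d : disj (xact (pref N x) t) (xact (pref N x) t1) by apply: disj_ext; congruence.
by apply: (d (ev (xact (pref N x) t) z)) => //; rewrite -e.
Qed.

(** If [N] is a level for [A], each word of length [N.+2] whose cone meets [A] contributes an
    element from [move_off], supported in [A] and moving its whole cone. These finitely many cones
    cover [A]. *)
Lemma clopen_closed_support A : clopen A ->
  exists F : seq D, forall x, closed_support F x <-> A x.
Proof.
move=> [N AN].
have /choice[f fP] w : exists g, size w.2 = N.+2 ->
    (exists2 x, A x & cone w x) ->
    supported A g /\ forall y, cone w y -> act g y <> y.
  have [[x Ax wx]|nx] := pselect (exists2 x, A x & cone w x); last by exists 1%g.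
  have [g [gs gm]] := move_off N x; exists g => sw _; split.
    apply: supported_sub gs => y /cone_prefP ey; apply: AN Ax.
    by rewrite -ey size_pref.
  by move/cone_prefP: wx; rewrite sw => <-.
exists [seq f w | w <- words n r N.+2 & `[< exists2 x, A x & cone w x >]] => x; split.
  move=> Ex; apply: contrapT => nA.
  have [|_ [y [/mapP[w + ->] cy fy]]] := Ex (pref N x); first exact: cone_pref.
  rewrite mem_filter mem_words => /andP[/asboolP wA /eqP sw].
  have [fs _] := fP _ sw wA; apply/fy/fs => Ay; apply: nA; apply: AN Ay.
  by move/cone_prefP: cy; rewrite size_pref.
move=> Ax w' wx; pose w : xword n r := pref N.+2 x.
have wA : exists2 x, A x & cone w x by exists x => //; exact: cone_pref.
have sw : size w.2 = N.+2 by rewrite size_pref.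
have [_ fm] := fP _ sw wA; exists (f w), x; split=> //; last by apply: fm; exact: cone_pref.
by apply: map_f; rewrite mem_filter mem_words sw eqxx andbT; apply/asboolP.
Qed.

(** Every cone supports a nontrivial element, so inclusion, and below disjointness and covering, can
    be read off from the subgroups of elements supported in the clopen sets. In this form they pass
    through an isomorphism. *)
Lemma clopen_subP A B : clopen A -> clopen B ->
  (forall x, A x -> B x) <-> (forall g, supported A g -> supported B g).
Proof.
move=> cA cB; split=> [AB g|AB x Ax]; first exact: supported_sub.
apply: contrapT => nB.
have [k kAB] := clopen_cone (clopenI cA (clopenC cB)) (conj Ax nB).
have [g gs g1] := cone_neq (pref k x).
have [y gy] := act_neq1 g1.
have ky : cone (pref k x) y by apply: contrapT => /gs.
apply: gy; apply: (AB g); last by have [] := kAB _ ky.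
by apply: supported_sub gs => z /kAB[].
Qed.

Lemma clopen_disjP A B : clopen A -> clopen B ->
  (forall x, A x -> ~ B x) <->
  (forall g, supported A g -> supported B g -> g = 1%g).
Proof.
move=> cA cB; split=> [AB g gA gB|AB x Ax Bx].
  apply: contrapT => /act_neq1[x gx].
  have [Ax|/gA//] := pselect (A x); exact/gx/gB/AB.
have [k kAB] := clopen_cone (clopenI cA cB) (conj Ax Bx).
have [g gs g1] := cone_neq (pref k x); apply/g1/AB; apply: supported_sub gs;
  by move=> y /kAB[].
Qed.

(** An element commuting with everything supported in the [B i] fixes each [B i] pointwise, and
    conversely. So a gap in the cover shows as a nontrivial such element supported in [A]. *)
Lemma clopen_coverP (I : finType) A (B : I -> _) : clopen A ->
  (forall i, clopen (B i)) ->
  (forall x, A x -> exists i, B i x) <->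
  (forall g, supported A g ->
     (forall i h, supported (B i) h -> commute g h) -> g = 1%g).
Proof.
move=> cA cB; split=> [AB g gA gB|AB x Ax].
  apply: contrapT => /act_neq1[x gx].
  have [Ax|/gA//] := pselect (A x); have [i Bx] := AB _ Ax.
  have [k kB] := clopen_cone (cB i) Bx.
  have [w [wx wk wg]] := act_shrink (cone_pref k x) gx.
  have [h hs h1] := cone_neq w; have [y hy] := act_neq1 h1.
  have wy : cone w y by apply: contrapT => /hs.
  apply: hy; apply: (@a_injr _ _ act (@actM _ _ n2 r1) (@act1 _ _ n2 r1) g).
  rewrite -actM -(gB i); last by apply: supported_sub hs => z /wk /kB.
  by rewrite actM hs //; exact: wg.
apply: contrapT => nB.
have [k kAB] := clopen_cone (clopenI cA (clopenC (clopenU cB))) (conj Ax nB).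
have [g gs g1] := cone_neq (pref k x); apply/g1/AB.
  by apply: supported_sub gs => y /kAB[].
move=> i h hs; apply: (disjoint_commute (@actM _ _ n2 r1) (@act1 _ _ n2 r1) (@act_inj _ _ n2 r1) gs).
by move=> y /kAB[_ nBy]; apply: hs => By; apply: nBy; exists i.
Qed.

Lemma translate_clopen g A : clopen A -> clopen (translate act g A).
Proof.
move=> [N AN]; have [M gM] := act_level g^-1%g.
exists (M + N) => x y exy; apply: AN.
have [|v gv] := gM (pref M x); first by rewrite size_pref.
set t := mkseq (fun i => x.2 (M + i)) (M + N - M).
have et : pref (M + N) x = xact (pref M x) t by apply: pref_ext; rewrite leq_addr.
apply: (@pref_eq _ _ _ (xact v t)).
- by rewrite size_cat size_mkseq addKn leq_addl.
- by rewrite -{1}(ev_pref (M + N) x) et ev_act gv -ev_act.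
- by rewrite -{1}(ev_pref (M + N) y) -exy et ev_act gv -ev_act.
Qed.

Definition clopen_parts q A (B : 'I_q -> point n r -> Prop) : Prop :=
  [/\ forall i, clopen (B i), forall x, A x <-> exists i, B i x &
      forall i j x, B i x -> B j x -> i = j].

Definition same_orbit A B : Prop := exists g, forall x, B x <-> translate act g A x.

End Clopens.

Section Reconstruction.
Variables (m r n s : nat) (m2 : 2 <= m) (r1 : 1 <= r) (n2 : 2 <= n) (s1 : 1 <= s).
Local Notation D := (derived (higman_thompson m2 r1)).
Local Notation E := (derived (higman_thompson n2 s1)).
Variables (phi : {multiplicative D -> E}) (psi : E -> D).
Hypotheses (phiK : cancel phi psi) (psiK : cancel psi phi).

Definition corr (A : point m r -> Prop) (B : point n s -> Prop) : Prop :=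
  [/\ clopen A, clopen B & forall g,
      supported (@act m r m2 r1) A g <-> supported (@act n s n2 s1) B (phi g)].

(** Write [A] as the closed support of a finite [F]. The elements supported in it form an
    algebraically defined centralizer, which [phi] carries to the one attached to [map phi F]. *)
Lemma corr_ex A : clopen A -> exists B, corr A B.
Proof.
move=> cA; have [F FA] := clopen_closed_support m2 r1 cA.
exists (closed_support (@act n s n2 s1) (@cone n s) (map phi F)); split=> //.
  exact: closed_support_clopen.
move=> g; rewrite -disj_centralizer_supp (disj_centralizer_iso phiK psiK).
rewrite disj_centralizer_supp.
by split; apply: supported_sub => x; rewrite FA.
Qed.

Lemma corr_sub A B A' B' : corr A B -> corr A' B' ->
  (forall x, A x -> A' x) <-> (forall x, B x -> B' x).
Proof.
move=> [cA cB AB] [cA' cB' AB'].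
rewrite (clopen_subP m2 r1 cA cA') (clopen_subP n2 s1 cB cB'); split=> S g.
  by rewrite -(psiK g) -AB -AB'; exact: S.
by rewrite AB AB'; exact: S.
Qed.

Lemma corr_disj A B A' B' : corr A B -> corr A' B' ->
  (forall x, A x -> ~ A' x) <-> (forall x, B x -> ~ B' x).
Proof.
move=> [cA cB AB] [cA' cB' AB'].
rewrite (clopen_disjP m2 r1 cA cA') (clopen_disjP n2 s1 cB cB'); split=> S g.
  rewrite -(psiK g) -AB -AB' => h1 h2; rewrite (S _ h1 h2).
  by apply: (@mulgI _ (phi 1%g)); rewrite -gmulfM !mulg1.
rewrite AB AB' => h1 h2; apply: (can_inj phiK); rewrite (S _ h1 h2).
by symmetry; apply: (@mulgI _ (phi 1%g)); rewrite -gmulfM !mulg1.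
Qed.

Let phi1 : phi 1%g = 1%g.
Proof. by apply: (@mulgI _ (phi 1%g)); rewrite -gmulfM !mulg1. Qed.

Lemma corr_cover (I : finType) A B (A' : I -> _) (B' : I -> _) : corr A B ->
  (forall i, corr (A' i) (B' i)) ->
  (forall x, A x -> exists i, A' i x) <-> (forall x, B x -> exists i, B' i x).
Proof.
move=> [cA cB AB] cAB'.
have cA' i : clopen (A' i) by case: (cAB' i).
have cB' i : clopen (B' i) by case: (cAB' i).
have AB' i g : supported (@act m r m2 r1) (A' i) g <->
    supported (@act n s n2 s1) (B' i) (phi g) by case: (cAB' i).
rewrite (clopen_coverP m2 r1 cA cA') (clopen_coverP n2 s1 cB cB'); split=> S g.
  rewrite -(psiK g) -AB => gA gc; rewrite (S _ gA) // => i h.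
  by rewrite AB' => /gc; rewrite (commute_iso phiK).
rewrite AB => gA gc; apply: (can_inj phiK); rewrite phi1; apply: S => // i h.
by rewrite -(psiK h) -AB' (commute_iso phiK) => /gc.
Qed.

Lemma corr_parts q A B (A' : 'I_q -> _) (B' : 'I_q -> _) : corr A B ->
  (forall i, corr (A' i) (B' i)) -> clopen_parts A A' -> clopen_parts B B'.
Proof.
move=> AB AB' [cA' eA' dA']; split=> [i|x|i j x ix jx].
- by case: (AB' i).
- split; first by apply/(corr_cover AB AB'): x => x /eA'.
  by move=> [i]; apply/(corr_sub (AB' i) AB): x => x ix; apply/eA'; exists i.
- apply: contrapT => ij; apply: (iffLR (corr_disj (AB' i) (AB' j))) ix jx.
  by move=> y iy jy; exact/ij/(dA' _ _ y).
Qed.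

(** Translating a set conjugates the subgroup supported in it, so orbits are respected. *)
Lemma corr_orbit A B A' B' : corr A B -> corr A' B' ->
  same_orbit m2 r1 A A' -> same_orbit n2 s1 B B'.
Proof.
move=> [cA cB AB] AB' [g gA]; exists (phi g).
have tr : corr (translate (@act m r m2 r1) g A) (translate (@act n s n2 s1) (phi g) B).
  split; try exact: translate_clopen.
  move=> u; rewrite !supported_conj; try by [exact: actM|exact: act1].
  have -> : (phi u ^ (phi g)^-1 = phi (u ^ g^-1))%g.
    rewrite /conjg !gmulfM invgK.
    have V k : (phi k)^-1%g = phi k^-1%g.
      by apply: (@mulgI _ (phi k)); rewrite mulgV -gmulfM mulgV phi1.
    by rewrite -V invgK V.
  exact: AB.
move=> x; split.
  by apply/(corr_sub AB' tr): x => x; rewrite gA.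
by apply/(corr_sub tr AB'): x => x; rewrite gA.
Qed.

Lemma corr_nonempty A B : corr A B -> (exists x, A x) <-> (exists x, B x).
Proof.
move=> AB; have := corr_disj AB AB; move=> H.
have N (T : Type) (P : T -> Prop) : (exists x, P x) <-> ~ (forall x, P x -> ~ P x).
  split=> [[x Px] h|h]; first exact: (h x Px Px).
  by apply: contrapT => nx; apply: h => x Px; case: nx; exists x.
by rewrite !N H.
Qed.

Lemma corr_full : corr (fun=> True) (fun=> True).
Proof. by split=> [||g]; [exists 0|exists 0|split=> _ x /(_ I)]. Qed.

Lemma corr_proper A B : corr A B -> (exists x, ~ A x) <-> (exists x, ~ B x).
Proof.
move=> AB; have H := corr_sub corr_full AB.
have N (T : Type) (P : T -> Prop) : (exists x, ~ P x) <-> ~ (forall x, True -> P x).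
  split=> [[x Px] h|h]; first exact: Px (h x I).
  by apply: contrapT => nx; apply: h => x _; apply: contrapT => Px; case: nx; exists x.
by rewrite !N H.
Qed.

End Reconstruction.

(** * Decompositions into cones *)

Lemma uniq_flatten_map (I T : eqType) (l : seq I) (F : I -> seq T) : uniq l ->
  (forall i, i \in l -> uniq (F i)) ->
  (forall i j x, i \in l -> j \in l -> x \in F i -> x \in F j -> i = j) ->
  uniq (flatten [seq F i | i <- l]).
Proof.
elim: l => //= i l IH /andP[il ul] uF dF; rewrite cat_uniq.
rewrite (uF i) ?mem_head //= IH //; first last.
- by move=> j k x jl kl; apply: dF; rewrite inE ?jl ?kl orbT.
- by move=> j jl; apply: uF; rewrite inE jl orbT.
rewrite andbT; apply/hasPn => x /flatten_mapP[j jl xj]; apply/negP => /= xi.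
have ij := dF i j x (mem_head _ _) (@mem_behead _ (i :: l) j jl) xi xj.
by move: il; rewrite ij jl.
Qed.

Lemma size_flatten_const (I T : eqType) (l : seq I) (F : I -> seq T) c d :
  (forall i, i \in l -> size (F i) = c %[mod d]) ->
  size (flatten [seq F i | i <- l]) = size l * c %[mod d].
Proof.
elim: l => //= i l IH Fc; rewrite size_cat mulSn -modnDm Fc ?mem_head //.
by rewrite IH ?modnDm // => j jl; apply: Fc; rewrite inE jl orbT.
Qed.

Section Decompositions.
Variables (n r : nat) (n2 : 2 <= n).
Implicit Types (u v w : xword n r) (x y : point n r) (s : seq (xword n r)).
Implicit Types A B : point n r -> Prop.

Definition dec A s : Prop :=
  [/\ uniq s, forall u v, u \in s -> v \in s -> u <> v -> disj u v &
      forall x, A x <-> exists2 u, u \in s & cone u x].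

Let z0 : iword n := fun=> letter n2 true.

Lemma dec_clopen A s : dec A s -> clopen A.
Proof.
move=> [_ _ As]; have [N sN] : exists N, forall u, u \in s -> size u.2 <= N.
  elim: (s) => [|u s' [N sN]]; first by exists 0.
  exists (maxn (size u.2) N) => v; rewrite inE leq_max.
  by move=> /orP[/eqP->|/sN->]; rewrite ?leqnn ?orbT.
exists N => x y e /As[u us ux]; apply/As; exists u => //.
apply/cone_prefP; move/cone_prefP: (ux) => <-; rewrite size_pref.
symmetry; apply: (@pref_eq _ _ _ (pref N x)); rewrite ?size_pref ?sN //.
by rewrite e.
Qed.

Lemma dec_flatten (I : eqType) (l : seq I) (P : I -> point n r -> Prop)
    (F : I -> seq (xword n r)) A : uniq l -> (forall i, i \in l -> dec (P i) (F i)) ->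
  (forall i j x, i \in l -> j \in l -> P i x -> P j x -> i = j) ->
  (forall x, A x <-> exists2 i, i \in l & P i x) ->
  dec A (flatten [seq F i | i <- l]).
Proof.
move=> ul PF dP AP.
have inP i u x : i \in l -> u \in F i -> cone u x -> P i x.
  by move=> il uF ux; case: (PF i il) => _ _ ->; exists u.
split.
- apply: uniq_flatten_map => // [i il|i j u il jl ui uj]; first by case: (PF i il).
  by apply: (dP i j (ev u z0)) => //; apply: (inP _ u).
- move=> u v /flatten_mapP[i il ui] /flatten_mapP[j jl vj] ne x ux vx.
  have ij : i = j by apply: (dP i j x) => //; [exact: inP ux|exact: inP vx].
  subst j; case: (PF i il) => _ d _; exact: d ne x ux vx.
- move=> x; rewrite AP; split=> [[i il]|[u /flatten_mapP[i il ui] ux]].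
    case: (PF i il) => _ _ -> [u ui ux]; exists u => //.
    by apply/flatten_mapP; exists i.
  by exists i => //; exact: inP ux.
Qed.

Lemma dec_cone u : dec (cone u) [:: u].
Proof.
split=> // [v w|x]; first by rewrite !inE => /eqP-> /eqP->.
by split=> [ux|[v]]; [exists u; rewrite ?mem_head|rewrite inE => /eqP->].
Qed.

Lemma dec_words k : dec (fun=> True) (words n r k).
Proof.
split; first exact: words_uniq.
  move=> u v; rewrite !mem_words => /eqP su /eqP sv ne x /cone_prefP ux /cone_prefP vx.
  by apply: ne; rewrite -ux -vx su sv.
by move=> x; split=> // _; exists (pref k x); rewrite // mem_words size_pref.
Qed.

Lemma dec_words_in k A : (forall x y, pref k x = pref k y -> A x -> A y) ->
  dec A [seq w <- words n r k | `[< forall x, cone w x -> A x >]].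
Proof.
move=> Ak; have [uw dw ew] := dec_words k; split; first exact: filter_uniq.
  by move=> u v; rewrite !mem_filter => /andP[_ uk] /andP[_ vk]; exact: dw.
move=> x; split=> [Ax|[w]]; last by rewrite mem_filter => /andP[/asboolP wA _] /wA.
exists (pref k x) => //; rewrite mem_filter mem_words size_pref eqxx andbT.
apply/asboolP => y /cone_prefP e; apply: Ak Ax.
by rewrite -e size_pref.
Qed.

Lemma clopen_dec A : clopen A -> exists N, forall M, N <= M ->
  exists s, dec A s /\ forall u, u \in s -> size u.2 = M.
Proof.
move=> [N AN]; exists N => M NM; exists [seq w <- words n r M | `[< forall x, cone w x -> A x >]].
split; first by apply: dec_words_in; exact: clopen_level NM.
by move=> u; rewrite mem_filter mem_words => /andP[_ /eqP].
Qed.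

Definition tails u k : seq (xword n r) :=
  [seq xact u (val t) | t <- enum {: k.-tuple 'I_n}].

Lemma xact_injr u : injective (xact u).
Proof. by move=> w w' [] /eqP; rewrite eqseq_cat // eqxx /= => /eqP. Qed.

Lemma size_tails u k : size (tails u k) = n ^ k.
Proof. by rewrite size_map -cardE card_tuple card_ord. Qed.

Lemma dec_tails u k : dec (cone u) (tails u k).
Proof.
split.
- rewrite map_inj_uniq ?enum_uniq // => t t' /xact_injr; exact: val_inj.
- move=> _ _ /mapP[t _ ->] /mapP[t' _ ->] ne; apply: disj_ext.
    by rewrite !size_tuple.
  by move=> e; apply: ne; rewrite e.
- move=> x; split=> [ux|[_ /mapP[t _ ->]]]; last exact: cone_act.
  have E : pref (size u.2 + k) x = xact u (mkseq (fun i => x.2 (size u.2 + i)) (size u.2 + k - size u.2)).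
    by have /cone_prefP eu := ux; rewrite (pref_ext x (leq_addr _ _)) eu.
  have st : size (mkseq (fun i => x.2 (size u.2 + i)) (size u.2 + k - size u.2)) == k.
    by rewrite size_mkseq addKn.
  exists (pref (size u.2 + k) x) => //.
  by rewrite E; apply/mapP; exists (Tuple st); rewrite // mem_enum.
Qed.

Lemma expn_mod_pred k : n ^ k = 1 %[mod n.-1].
Proof.
have -> : n ^ k = (n.-1 + 1) ^ k by rewrite addn1 prednK // (ltn_trans _ n2).
by rewrite -modnXm modnDl modnXm exp1n.
Qed.

Lemma dec_refine A s k : dec A s -> (forall u, u \in s -> size u.2 <= k) ->
  exists s', [/\ dec A s', forall u, u \in s' -> size u.2 = k &
    size s' = size s %[mod n.-1]].
Proof.
move=> [us ds As] sk; exists (flatten [seq tails u (k - size u.2) | u <- s]); split.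
- apply: (@dec_flatten _ s (@cone n r)) => // [u _|u v x ul vl ux vx].
    exact: dec_tails.
  by apply: contrapT => ne; exact: (ds u v ul vl ne x ux vx).
- move=> _ /flatten_mapP[u ul /mapP[t _ ->]] /=.
  by rewrite size_cat size_tuple subnKC // sk.
- rewrite -[size s]muln1; apply: size_flatten_const => u _.
  by rewrite size_tails expn_mod_pred.
Qed.

(** Cutting a cone into its n subcones adds n-1 cones. Refine both decompositions to one word length
    [k] without changing their sizes modulo n-1; at a fixed length the decomposition is determined
    by [A]. *)
Lemma dec_size A s s' : dec A s -> dec A s' -> size s = size s' %[mod n.-1].
Proof.
move=> ds ds'; pose k := \max_(u <- s ++ s') size u.2.
have le u : u \in s ++ s' -> size u.2 <= k.
  by move=> us; exact: (@leq_bigmax_seq _ _ xpredT (fun u => size u.2)).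
have [t [[ut dt At] tk <-]] := dec_refine ds (fun u us => le u (etrans (mem_cat u s s') (introT orP (or_introl us)))).
have [t' [[ut' dt' At'] tk' <-]] := dec_refine ds' (fun u us => le u (etrans (mem_cat u s s') (introT orP (or_intror us)))).
congr (_ %% _); apply/perm_size/uniq_perm => // u.
have H (a b : seq (xword n r)) : (forall x, A x <-> exists2 u, u \in a & cone u x) ->
    (forall x, A x <-> exists2 u, u \in b & cone u x) ->
    (forall u, u \in a -> size u.2 = k) -> (forall u, u \in b -> size u.2 = k) ->
    u \in a -> u \in b.
  move=> Aa Ab ak bk ua; have /Ab[v vb /cone_prefP] : A (ev u z0) by apply/Aa; exists u.
  by rewrite (bk v vb) -(ak u ua) pref_ev => ->.
by apply/idP/idP; exact: H.
Qed.

Lemma dec_nil A s : dec A s -> (exists x, A x) <-> 0 < size s.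
Proof.
move=> [_ _ As]; split=> [[x /As[u us _]]|]; first by case: s us {As}.
by case: s As => // u s As _; exists (ev u z0); apply/As; exists u; rewrite ?mem_head.
Qed.

Lemma dec_expand1 A s : dec A s -> 0 < size s ->
  exists2 s', dec A s' & size s' = size s + n.-1.
Proof.
case: s => // u s [us ds As] _.
exists (flatten [seq (if v == u then tails u 1 else [:: v]) | v <- u :: s]).
  apply: (@dec_flatten _ (u :: s) (@cone n r)) => // [v _|v w x vl wl vx wx].
    by case: eqP => [->|_]; [exact: dec_tails|exact: dec_cone].
  by apply: contrapT => ne; exact: (ds v w vl wl ne x vx wx).
rewrite /= eqxx size_cat size_tails expn1.
have -> : [seq (if v == u then tails u 1 else [:: v]) | v <- s] = [seq [:: v] | v <- s].
  apply/eq_in_map => v vs; case: eqP => // e; move: us; by rewrite /= -e vs.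
have -> : flatten [seq [:: v] | v <- s] = s by elim: (s) => //= v s' ->.
by have := n2; lia.
Qed.

Lemma dec_expand A s k : dec A s -> 0 < size s -> size s <= k ->
  k = size s %[mod n.-1] -> exists2 s', dec A s' & size s' = k.
Proof.
move=> ds s0 sk e.
have /dvdnP[q eq] : n.-1 %| k - size s by rewrite -eqn_mod_dvd //; apply/eqP.
have -> : k = size s + q * n.-1 by rewrite -eq subnKC.
elim: q {eq} => [|q [s' ds' es']]; first by exists s; rewrite ?addn0.
have [|s'' ds'' es''] := dec_expand1 ds'; first by rewrite es' ltn_addr.
by exists s'' => //; rewrite es'' es' mulSn addnAC -addnA.
Qed.

Lemma dec_chunks A s q a : dec A s -> size s = q * a ->
  exists B : 'I_q -> point n r -> Prop, clopen_parts A B /\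
    forall i, exists2 s', dec (B i) s' & size s' = a.
Proof.
move=> [us ds As] sz.
(* A word is needed as default value for [nth]. Without any word [s] is empty, and [a] is 0 as soon
   as there is an index. *)
have [[u0 _]|] := pselect (exists u : xword n r, True); last first.
  move=> nu; have s0 : s = [::] by case: (s) nu => // u s' []; exists u.
  exists (fun _ _ => False); split.
    split=> [i|x|//]; first by exists 0.
    by split=> [/As[]|[]//]; rewrite s0.
  have a0 (i : 'I_q) : a = 0 by move: sz; rewrite s0 /=; case: q i => [[]//|q] _; case: a.
  move=> i; exists [::]; last by rewrite (a0 i).
  by split=> // x; split=> // -[].
pose c (i : 'I_q) := [seq nth u0 s (i * a + j) | j <- iota 0 a].
have lt (i : 'I_q) j : j < a -> i * a + j < size s.
  move=> ja; rewrite sz; apply: leq_trans (_ : i.+1 * a <= _).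
    by rewrite mulSn addnC ltn_add2r.
  by rewrite leq_mul2r ltn_ord orbT.
have cs i u : u \in c i -> u \in s.
  by move=> /mapP[j]; rewrite mem_iota => /= ja ->; exact/mem_nth/lt.
have cinj i j u : u \in c i -> u \in c j -> i = j.
  move=> /mapP[k + ->] /mapP[l]; rewrite !mem_iota /= => ka la /eqP.
  rewrite nth_uniq ?lt // => /eqP e; apply: val_inj => /=.
  have a0 : 0 < a by exact: leq_trans ka.
  by have := congr1 (divn^~ a) e; rewrite !divnMDl // !divn_small // !addn0.
have dc i : dec (fun x => exists2 u, u \in c i & cone u x) (c i).
  split=> //; last by move=> u v /cs ui /cs vi; exact: ds.
  rewrite map_inj_in_uniq ?iota_uniq // => k l; rewrite !mem_iota /= => ka la /eqP.
  by rewrite nth_uniq ?lt // eqn_add2l => /eqP.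
exists (fun i x => exists2 u, u \in c i & cone u x); split; last first.
  by move=> i; exists (c i) => //; rewrite size_map size_iota.
split=> [i|x|i j x [u ui ux] [v vj vx]]; first exact: dec_clopen (dc i).
  split=> [/As[u us' ux]|[i [u ui ux]]]; last by apply/As; exists u => //; exact: cs ui.
  have a0 : 0 < a by move: us'; rewrite -index_mem sz; case: (a); rewrite ?muln0.
  have iq : index u s %/ a < q by rewrite ltn_divLR // -sz index_mem.
  exists (Ordinal iq), u => //; apply/mapP; exists (index u s %% a).
    by rewrite mem_iota /= ltn_mod.
  by rewrite /= -divn_eq nth_index.
have [uv|ne] := pselect (u = v); first by subst v; exact: (cinj i j u).
by case: (ds u v (cs _ _ ui) (cs _ _ vj) ne x).
Qed.

Lemma disj_size u v : size u.2 = size v.2 -> u <> v -> disj u v.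
Proof.
move=> suv ne x /cone_prefP ux /cone_prefP vx.
by apply: ne; rewrite -ux -vx suv.
Qed.

Lemma cone_class p c : exists A s, [/\ dec A s, 0 < size s,
  size s = c %[mod n.-1], forall x, A x -> cone p x &
  exists2 x, cone p x & ~ A x].
Proof.
(* The representative of [c] modulo n-1 between 1 and n-1: the first [c'] of the n subcones of [p]
   are then neither none nor all of them. *)
pose c' := if c %% n.-1 == 0 then n.-1 else c %% n.-1.
have n1 : 0 < n.-1 by have := n2; lia.
have c0 : 0 < c' by rewrite /c'; case: eqP => // /eqP; rewrite lt0n.
have cn : c' < n.
  rewrite /c'; case: eqP => _; first by have := n2; lia.
  by have := ltn_pmod c n1; have := n2; lia.
have ce : c' = c %[mod n.-1].
  by rewrite /c'; case: eqP => [->|_]; rewrite ?modnn ?modn_mod.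
pose s := [seq xact p [:: a] | a <- enum 'I_n & (val a < c')%N].
have si (u : xword n r) : u \in s -> exists2 a : 'I_n, val a < c' & u = xact p [:: a].
  by move=> /mapP[a]; rewrite mem_filter => /andP[ac _] ->; exists a.
exists (fun x => exists2 u, u \in s & cone u x), s; split.
- split=> // [|u v /si[a _ ->] /si[b _ ->] ne].
    rewrite map_inj_uniq; first exact/filter_uniq/enum_uniq.
    by move=> a b /xact_injr [].
  by apply: disj_ext => // e; apply: ne; rewrite e.
- rewrite size_map size_filter -has_count; apply/hasP; exists (Ordinal (ltnW n2)).
    exact: mem_enum.
  exact: c0.
- rewrite size_map size_filter -ce; congr (_ %% _).
  rewrite -(count_map val (fun i => i < c')) val_enum_ord.
  rewrite -size_filter -[X in iota 0 X](subnKC (ltnW cn)) iotaD filter_cat size_cat.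
  rewrite (@eq_in_filter _ _ xpredT) ?filter_predT ?size_iota; last first.
    by move=> i; rewrite mem_iota.
  rewrite (@eq_in_filter _ _ pred0) ?filter_pred0 ?addn0 // => i.
  by rewrite mem_iota add0n => /andP[ci _] /=; rewrite ltnNge ci.
- by move=> x [u /si[a _ ->] /cone_act].
- exists (ev (xact p [:: Ordinal cn]) z0); first by rewrite ev_act; exact: cone_ev.
  move=> [u /si[a ac ->]]; apply: (@disj_ext _ _ p [:: Ordinal cn] [:: a]) => //.
  by move=> [e]; move: ac; rewrite -e /= ltnn.
Qed.

End Decompositions.

(** * Orbits of clopen sets *)

Section Orbits.
Variables (n r : nat) (n2 : 2 <= n) (r1 : 1 <= r).
Local Notation D := (derived (higman_thompson n2 r1)).
Local Notation act := (@act n r n2 r1).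
Local Notation same_orbit := (same_orbit n2 r1).
Local Notation dec_size := (dec_size n2).
Implicit Types (x y : point n r) (s : seq (xword n r)).
Implicit Types A B C : point n r -> Prop.

Let actK (g : D) : cancel (act g) (act g^-1%g).
Proof. exact: (aK (@actM _ _ n2 r1) (@act1 _ _ n2 r1)). Qed.
Let actVK (g : D) : cancel (act g^-1%g) (act g).
Proof. exact: (aVK (@actM _ _ n2 r1) (@act1 _ _ n2 r1)). Qed.

Lemma same_orbit_refl A : same_orbit A A.
Proof. by exists 1%g => x; rewrite /translate invg1 act1. Qed.

Lemma same_orbit_trans A B C : same_orbit A B -> same_orbit B C -> same_orbit A C.
Proof.
move=> [g AB] [h BC]; exists (g * h)%g => x.
by rewrite BC /translate AB /translate invgM actM.
Qed.

(** At a level fine enough for both [A] and [g], the element [g] carries cones bijectively to cones,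
    so the class modulo n-1 is an invariant of the orbit. *)
Lemma same_orbit_dec A B s : same_orbit A B -> dec A s ->
  exists2 s', dec B s' & size s' = size s %[mod n.-1].
Proof.
move=> [g AB] dA.
have [N AN] := clopen_dec (dec_clopen dA); have [M gM] := act_level g.
have [t [dt tN]] := AN (maxn N M) (leq_maxl _ _).
have /choice[f fP] u : exists v, u \in t -> forall z, act g (ev u z) = ev v z.
  have [ut|nu] := boolP (u \in t); last by exists u.
  by have [|v gv] := gM u; [rewrite tN ?leq_maxr|exists v].
exists (map f t); last by rewrite size_map; exact: dec_size dt dA.
case: dt => ut dt At; split.
- rewrite map_inj_in_uniq // => u v ui vi e; apply: (ev_sep n2) => z.
  by apply: (can_inj (actK g)); rewrite (fP u ui) (fP v vi) e.
- move=> _ _ /mapP[u ui ->] /mapP[v vi ->] ne x [z ->] [z' e].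
  apply: (dt u v ui vi) (ev u z) _ _ => //; first by move=> uv; apply: ne; rewrite uv.
  exists z'; apply: (can_inj (actK g)).
  by rewrite (fP u ui) (fP v vi).
- move=> x; rewrite AB /translate At; split=> [[u ui [z e]]|[_ /mapP[u ui ->] [z ->]]].
    exists (f u); first exact: map_f.
    by exists z; rewrite -(fP u ui) -e actVK.
  by exists u => //; exists z; rewrite -(fP u ui) actK.
Qed.

(** A product of 3-cycles with disjoint supports, one for each index. The cones [w i] serve to close
    the cycles, so that no transposition has to lie in the derived group. *)
Lemma multi_cycle (I : eqType) (l : seq I) (u v w : I -> xword n r) :
  uniq l ->
  (forall i j, i \in l -> j \in l -> i <> j ->
     [/\ disj (u i) (u j), disj (v i) (v j) & disj (w i) (w j)]) ->
  (forall i j, i \in l -> j \in l ->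
     [/\ disj (u i) (v j), disj (v i) (w j) & disj (u i) (w j)]) ->
  exists g, (forall i z, i \in l -> act g (ev (u i) z) = ev (v i) z) /\
    forall x, (forall i, i \in l -> [/\ ~ cone (u i) x, ~ cone (v i) x & ~ cone (w i) x]) ->
      act g x = x.
Proof.
elim: l => [|i l IH] /=; first by move=> _ _ _; exists 1%g; split=> // x _; exact: act1.
move=> /andP[il ul] d1 d2.
have [||g [gu go]] := IH ul.
- by move=> j k jl kl; apply: d1; rewrite inE ?jl ?kl orbT.
- by move=> j k jl kl; apply: d2; rewrite inE ?jl ?kl orbT.
have [uv vw uw] := d2 i i (mem_head _ _) (mem_head _ _).
have [h [h1 h2 h3 ho]] := three_cycle n2 r1 uv vw uw.
have ne j : j \in l -> i <> j by move=> jl ij; move: il; rewrite ij jl.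
exists (h * g)%g; split=> [j z|x nx]; rewrite actM.
  rewrite inE => /orP[/eqP->|jl].
    rewrite h1; apply: go => k kl; have kl' : k \in i :: l by rewrite inE kl orbT.
    have [_ vv _] := d1 i k (mem_head _ _) kl' (ne _ kl).
    have [_ vwk _] := d2 i k (mem_head _ _) kl'.
    have [uvk _ _] := d2 k i kl' (mem_head _ _).
    split; [exact: disj_sym uvk _ (cone_ev _ _)|exact: vv|exact: vwk].
  rewrite ho ?gu //; have jl' : j \in i :: l by rewrite inE jl orbT.
  - by have [uu _ _] := d1 i j (mem_head _ _) jl' (ne _ jl); exact: disj_sym uu _ (cone_ev _ _).
  - by have [uvj _ _] := d2 j i jl' (mem_head _ _); exact: uvj.
  - by have [_ _ uwj] := d2 j i jl' (mem_head _ _); exact: uwj.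
have [n1 n3 n4] := nx i (mem_head _ _).
rewrite ho // go // => j jl; apply: nx; by rewrite inE jl orbT.
Qed.

Lemma same_orbit_disjoint3 A B C s t p : dec A s -> dec B t -> dec C p ->
  0 < size s -> size t = size s -> size p = size s ->
  (forall x, A x -> ~ B x) -> (forall x, B x -> ~ C x) -> (forall x, A x -> ~ C x) ->
  same_orbit A B.
Proof.
move=> [us ds As] [ut dt Bt] [up dp Cp] s0 st sp AB BC AC.
have [u0 _] : exists u, u \in s by case: s s0 {us ds As st sp} => // u s _; exists u; rewrite mem_head.
have lt i : i \in iota 0 (size s) -> i < size s by rewrite mem_iota.
have dn q (uq : uniq q) (dq : forall u v, u \in q -> v \in q -> u <> v -> disj u v) i j :
    size q = size s -> i < size s -> j < size s -> i <> j -> disj (nth u0 q i) (nth u0 q j).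
  move=> sq li lj ij; apply: dq; rewrite ?mem_nth ?sq //.
  by apply/eqP; rewrite nth_uniq ?sq //; apply/eqP.
have dd (P Q : point n r -> Prop) (q q' : seq (xword n r)) i j :
    (forall x, P x <-> exists2 u, u \in q & cone u x) ->
    (forall x, Q x <-> exists2 u, u \in q' & cone u x) ->
    (forall x, P x -> ~ Q x) -> size q = size s -> size q' = size s ->
    i < size s -> j < size s -> disj (nth u0 q i) (nth u0 q' j).
  move=> Pq Qq PQ sq sq' li lj x ux vx; apply: (PQ x).
    by apply/Pq; exists (nth u0 q i) => //; rewrite mem_nth ?sq.
  by apply/Qq; exists (nth u0 q' j) => //; rewrite mem_nth ?sq'.
have [i j /lt li /lt lj ij|i j /lt li /lt lj|g [gu _]] :=
    @multi_cycle _ (iota 0 (size s)) (nth u0 s) (nth u0 t) (nth u0 p) (iota_uniq _ _).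
- by split; apply: dn.
- by split; [apply: (dd A B)|apply: (dd B C)|apply: (dd A C)].
exists g => x; rewrite /translate Bt As; split=> [[v vt [z ->]]|[u us' [z e]]].
  exists (nth u0 s (index v t)); first by rewrite mem_nth // -st index_mem.
  exists z; apply: (can_inj (actK g)); rewrite actVK gu; last by rewrite mem_iota -st /= index_mem.
  by rewrite nth_index.
exists (nth u0 t (index u s)); first by rewrite mem_nth // st index_mem.
exists z; rewrite -gu; last by rewrite mem_iota /= index_mem.
by rewrite nth_index // -e actVK.
Qed.

(** Room left outside both sets contains a third set [C] of the same class. Expanding the three
    decompositions to a common number [M] of cones allows 3-cycles to carry [A] onto [B]. *)
Lemma same_orbit_disjoint A B s t : dec A s -> dec B t -> 0 < size s -> 0 < size t ->
  size s = size t %[mod n.-1] -> (forall x, A x -> ~ B x) ->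
  (exists x, ~ A x /\ ~ B x) -> same_orbit A B.
Proof.
move=> dA dB s0 t0 st AB [x nx].
have [k kx] := clopen_cone (clopenI (clopenC (dec_clopen dA)) (clopenC (dec_clopen dB))) nx.
have [C [p [dC p0 ps Ck _]]] := cone_class n2 (pref k x) (size s).
have n1 : 0 < n.-1 by have := n2; lia.
pose M := size s + n.-1 * (size t + size p).
have Ms : M = size s %[mod n.-1] by rewrite /M mulnC addnC modnMDl.
have le1 a : a <= size t + size p -> a <= M.
  by move=> h; apply: leq_trans h _; rewrite /M; nia.
have [||s' dA' sM] := dec_expand n2 dA s0 (k := M); rewrite ?leq_addr //.
have [||t' dB' tM] := dec_expand n2 dB t0 (k := M).
- by apply: le1; rewrite leq_addr.
- by rewrite Ms.
have [||p' dC' pM] := dec_expand n2 dC p0 (k := M).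
- by apply: le1; rewrite leq_addl.
- by rewrite Ms.
apply: (same_orbit_disjoint3 dA' dB' dC'); rewrite ?sM ?tM ?pM //.
- by rewrite /M ltn_addr.
- by move=> y By /Ck /kx[].
- by move=> y Ay /Ck /kx[].
Qed.

(** The sets may overlap or fill the space together, so the path goes from [A] to [A1], to [B1], to
    [B], where [A1] lies in a cone off [A], [B1] in a cone off [B], and these cones are disjoint. As
    [A1] and [B1] do not fill their cones, each step leaves room for [same_orbit_disjoint]. *)
Lemma same_orbit_class A B s t : dec A s -> dec B t -> 0 < size s -> 0 < size t ->
  size s = size t %[mod n.-1] -> (exists x, ~ A x) -> (exists x, ~ B x) ->
  same_orbit A B.
Proof.
move=> dA dB s0 t0 st [x nAx] [y nBy].
have [k kx] := clopen_cone (clopenC (dec_clopen dA)) nAx.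
have [l ly] := clopen_cone (clopenC (dec_clopen dB)) nBy.
have [p [q [pq pA qB]]] : exists p q : xword n r, [/\ disj p q,
    forall z, cone p z -> ~ A z & forall z, cone q z -> ~ B z].
  pose M := maxn k l.
  have sub j z t' : j <= M -> cone (pref M z) t' -> cone (pref j z) t'.
    move=> jM /cone_prefP; rewrite size_pref => e; apply/cone_prefP.
    rewrite size_pref; apply: (@pref_eq _ _ _ (pref M z)); rewrite ?size_pref //.
    by apply/cone_prefP; rewrite size_pref.
  have [e|ne] := pselect (pref M x = pref M y); last first.
    exists (pref M x), (pref M y); split; first by apply: disj_size => //; rewrite !size_pref.
      by move=> z /(sub _ _ k x z (leq_maxl _ _)) /kx.
    by move=> z /(sub _ _ l y z (leq_maxr _ _)) /ly.
  exists (xact (pref M x) [:: letter n2 true]), (xact (pref M y) [:: letter n2 false]).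
  split; first by rewrite e; apply: disj_ext => // -[] /(letter_inj (n2 := n2)).
    by move=> z /cone_act /(sub _ _ k x z (leq_maxl _ _)) /kx.
  by move=> z /cone_act /(sub _ _ l y z (leq_maxr _ _)) /ly.
have [A1 [a [dA1 a0 ea Ap [x1 px1 nx1]]]] := cone_class n2 p (size s).
have [B1 [b [dB1 b0 eb Bq [y1 qy1 ny1]]]] := cone_class n2 q (size s).
apply: (@same_orbit_trans _ A1).
  apply: (same_orbit_disjoint dA dA1) => //; first by move=> z Az /Ap /pA.
  by exists x1; split=> //; exact: pA.
apply: (@same_orbit_trans _ B1).
  apply: (same_orbit_disjoint dA1 dB1) => //; first by rewrite ea eb.
    by move=> z /Ap pz /Bq; exact: pq.
  by exists x1; split=> // /Bq; exact: pq.
apply: (same_orbit_disjoint dB1 dB) => //; first by rewrite eb.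
  by move=> z /Bq /qB.
by exists y1; split=> //; exact: qB.
Qed.

Lemma parts_size q A (B : 'I_q -> _) s c : clopen_parts A B -> dec A s ->
  (forall i, exists2 t, dec (B i) t & size t = c %[mod n.-1]) ->
  size s = q * c %[mod n.-1].
Proof.
move=> [cB eB dB] dA H.
have /choice[F FP] i : exists t, dec (B i) t /\ size t = c %[mod n.-1].
  by have [t] := H i; exists t.
have dF : dec A (flatten [seq F i | i <- enum 'I_q]).
  apply: (dec_flatten n2 (P := B)); first exact: enum_uniq.
  - by move=> i _; case: (FP i).
  - by move=> i j x _ _; exact: dB.
  - by move=> x; rewrite eB; split=> -[i]; exists i; rewrite ?mem_enum.
rewrite (dec_size dA dF) (@size_flatten_const _ _ _ _ c) ?size_enum_ord //.
by move=> i _; case: (FP i).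
Qed.

Definition splits_proper k : Prop := forall A, clopen A -> (exists x, A x) ->
  (exists x, ~ A x) -> exists B : 'I_k.+1 -> point n r -> Prop,
    clopen_parts A B /\ forall i, same_orbit A (B i).

(** Splitting a single cone into k+1 parts of its own class gives 1 = k+1 modulo n-1. Conversely, if
    n-1 divides k, the cones of [A] can be expanded to k+1 times their number and cut into equal
    blocks. *)
Lemma splits_properP k : splits_proper k <-> n.-1 %| k.
Proof.
have n1 : 0 < n.-1 by have := n2; lia.
split=> [S|/dvdnP[q ->] A cA neA prA].
  pose u : xword n r := (Ordinal r1, [:: letter n2 true]).
  pose z0 : iword n := fun=> letter n2 true.
  have [||B [pB oB]] := S (cone u) (@cone_clopen _ _ u).
  - by exists (ev u z0).
  - exists (Ordinal r1, fun=> letter n2 false) => -[z [/funeqP /(_ 0) /= e]].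
    by have := @letter_inj _ n2 false true e.
  have : size [:: u] = k.+1 * 1 %[mod n.-1].
    apply: (parts_size pB (dec_cone u)) => i.
    by have [t] := same_orbit_dec (oB i) (dec_cone u); exists t.
  by rewrite muln1 => /esym/eqP; rewrite eqn_mod_dvd // subSS subn0.
have [N /(_ N (leqnn N))[s [dA _]]] := clopen_dec cA.
have s0 : 0 < size s by apply/(dec_nil n2 dA).
have [||s' dA' es'] := dec_expand n2 dA s0 (k := (q * n.-1).+1 * size s).
- by rewrite mulSn leq_addr.
- by rewrite mulSn addnC mulnAC modnMDl.
have [B [pB sB]] := dec_chunks dA' es'.
exists B; split=> // i; have [t dt et] := sB i.
apply: (same_orbit_class dA dt) => //; rewrite ?et //.
have [x nx] := prA; exists x => Bx; apply: nx.
by case: pB => _ -> _; exists i.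
Qed.

Definition splits_whole t : Prop := exists B : 'I_t -> point n r -> Prop,
  clopen_parts (fun=> True) B /\ forall i j, same_orbit (B i) (B j).

(** The whole space consists of [r] cones, so [t] parts of one class c give r = t * c modulo n-1,
    hence modulo [t] because [t] divides n-1. Conversely, the [r] cones are cut into [t] equal
    blocks. *)
Lemma splits_wholeP t : t %| n.-1 -> splits_whole t <-> t %| r.
Proof.
move=> tn; have n1 : 0 < n.-1 by have := n2; lia.
have t0 : 0 < t by exact: dvdn_gt0 tn.
have dT : dec (fun=> True) (words n r 0) by exact: dec_words.
have sT : size (words n r 0) = r by rewrite size_words expn0 muln1.
split=> [[B [pB oB]]|/dvdnP[a ra]].
  have cB i : clopen (B i) by case: pB.
  have [N /(_ N (leqnn N))[s [dB _]]] := clopen_dec (cB (Ordinal t0)).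
  have : size (words n r 0) = t * size s %[mod n.-1].
    apply: (parts_size pB dT) => i.
    by have [s'] := same_orbit_dec (oB (Ordinal t0) i) dB; exists s'.
  by rewrite sT => e; rewrite /dvdn -(modn_dvdm _ tn) e modn_dvdm // modnMr.
have [||B [pB sB]] := @dec_chunks _ _ (fun=> True) (words n r 0) t a; first exact: dT.
  by rewrite sT ra mulnC.
have a0 : 0 < a by move: r1; rewrite ra; case: (a).
exists B; split=> // i j.
(* For t = 1 the single part is the whole space, to which [same_orbit_class] does not apply; two
   distinct parts are both proper. *)
have [->|ij] := eqVneq i j; first exact: same_orbit_refl.
have [[s ds es] [s' ds' es']] := (sB i, sB j).
have ne k l : k <> l -> exists x, ~ B k x.
  move=> kl; have [s1 ds1 es1] := sB l.
  have [|x Bx] := (dec_nil n2 ds1).2; first by rewrite es1.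
  by exists x => Bkx; apply: kl; case: pB => _ _; apply; eauto.
apply: (same_orbit_class ds ds'); rewrite ?es ?es' //.
  by apply: (ne i j); exact/eqP.
by apply: (ne j i) => e; move: ij; rewrite e eqxx.
Qed.

End Orbits.

(** * Numerical invariants of the derived group *)

Section Necessity.
Variables (m r n s : nat) (m2 : 2 <= m) (r1 : 1 <= r) (n2 : 2 <= n) (s1 : 1 <= s).
Local Notation D := (derived (higman_thompson m2 r1)).
Local Notation E := (derived (higman_thompson n2 s1)).
Variables (phi : {multiplicative D -> E}) (psi : {multiplicative E -> D}).
Hypotheses (phiK : cancel phi psi) (psiK : cancel psi phi).

Let corr_sym A B : corr psi A B -> corr phi B A.
Proof.
by move=> [cA cB AB]; split=> // g; rewrite -{1}(phiK g) AB ?phiK.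
Qed.

Lemma splits_proper_iso k : splits_proper m2 r1 k -> splits_proper n2 s1 k.
Proof.
move=> S B cB neB prB.
have [A /corr_sym AB] := corr_ex psiK phiK cB.
have cA : clopen A by case: AB.
have [||A' [pA oA]] := S A cA.
- exact/(corr_nonempty phiK psiK AB).
- exact/(corr_proper psiK AB).
have /choice[B' AB'] i : exists B', corr phi (A' i) B'.
  by apply: (corr_ex phiK psiK); case: pA.
exists B'; split; first exact: (corr_parts phiK psiK AB AB' pA).
by move=> i; exact: (corr_orbit psiK AB (AB' i) (oA i)).
Qed.

Lemma splits_whole_iso t : splits_whole m2 r1 t -> splits_whole n2 s1 t.
Proof.
move=> [A [pA oA]].
have /choice[B AB] i : exists B, corr phi (A i) B.
  by apply: (corr_ex phiK psiK); case: pA.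
exists B; split; first exact: (corr_parts phiK psiK (corr_full _) AB pA).
by move=> i j; exact: (corr_orbit psiK (AB i) (AB j) (oA i j)).
Qed.

End Necessity.

(** The numbers m-1 and n-1 have the same multiples, hence are equal. Then [r] and [s] have the same
    divisors among the divisors of m-1, hence the same greatest common divisor with it. *)
Lemma derived_iso_invariants (m r n s : nat) (m2 : 2 <= m) (r1 : 1 <= r)
    (n2 : 2 <= n) (s1 : 1 <= s) :
  group_isomorphic (derived (higman_thompson m2 r1))
                   (derived (higman_thompson n2 s1)) ->
  m = n /\ gcdn (n - 1) r = gcdn (n - 1) s.
Proof.
move=> [phi [psi phiK psiK]].
have psiM : {morph psi : x y / (x * y)%g} by exact: can2_gmulfM phiK psiK.
pose psi' : {multiplicative _ -> _} := HB.pack psi (isMultiplicative.Build _ _ psi psiM).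
have psi'K : cancel psi' phi by [].
have phi'K : cancel phi psi' by [].
have emn : m = n.
  have E k : (m.-1 %| k) = (n.-1 %| k).
    apply/idP/idP.
      move=> /(splits_properP m2 r1) H; apply/(splits_properP n2 s1).
      exact: (splits_proper_iso phi'K psi'K).
    move=> /(splits_properP n2 s1) H; apply/(splits_properP m2 r1).
    exact: (splits_proper_iso psi'K phi'K).
  suff : m.-1 = n.-1 by lia.
  by apply/eqP; rewrite eqn_dvd E dvdnn -E dvdnn.
subst n; split=> //; rewrite subn1.
have D t : t %| m.-1 -> (t %| r) = (t %| s).
  move=> tm; apply/idP/idP.
    move=> /(splits_wholeP m2 r1 tm) H; apply/(splits_wholeP n2 s1 tm).
    exact: (splits_whole_iso phi'K psi'K).
  move=> /(splits_wholeP n2 s1 tm) H; apply/(splits_wholeP m2 r1 tm).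
  exact: (splits_whole_iso psi'K phi'K).
by apply/eqP; rewrite eqn_dvd !dvdn_gcd !dvdn_gcdl /= -D ?dvdn_gcdl // dvdn_gcdr D ?dvdn_gcdl // dvdn_gcdr.
Qed.

(** * Interdefinable structures *)

(* A kind of structure on a type, with its homomorphisms; hidden sorts of the  *)
(* structure are part of [str Y] and existentially quantified in [hom].        *)
Record theory := Theory {
  str : Type -> Type;
  hom : forall Y Z, str Y -> str Z -> (Y -> Z) -> Prop;
  hom_id : forall Y (s : str Y), hom s s id;
  hom_comp : forall Y Z W (s : str Y) (t : str Z) (u : str W) f g,
    hom s t f -> hom t u g -> hom s u (g \o f)
}.

(** A relation replaces a pair of inverse maps because a structure with a hidden sort matters only
    up to isomorphism inducing the identity on [Y]. Agreement of homomorphisms is what transfers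
    freeness and automorphisms. *)
Definition interdefinable (T U : theory) : Prop :=
  exists R : forall Y, str T Y -> str U Y -> Prop,
    [/\ forall Y (s : str T Y), exists t, R Y s t,
        forall Y (t : str U Y), exists s, R Y s t &
        forall Y Z s s' t t' (h : Y -> Z), R Y s t -> R Z s' t' ->
          hom s s' h <-> hom t t' h].

Lemma interdefinable_refl T : interdefinable T T.
Proof.
exists (fun Y => @eq (str T Y)); split=> [Y s|Y s|Y Z s s' t t' h -> -> //];
  by exists s.
Qed.

Lemma interdefinable_sym T U : interdefinable T U -> interdefinable U T.
Proof.
move=> [R [lt rt RP]]; exists (fun Y s t => R Y t s); split=> //.
by move=> Y Z s s' t t' h Rs Rs'; rewrite (RP _ _ _ _ _ _ h Rs Rs').
Qed.

Lemma interdefinable_trans T U V :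
  interdefinable T U -> interdefinable U V -> interdefinable T V.
Proof.
move=> [R [lt rt RP]] [S [lt' rt' SP]].
exists (fun Y s v => exists2 u, R Y s u & S Y u v); split.
- by move=> Y s; have [u Ru] := lt Y s; have [v Sv] := lt' Y u; exists v, u.
- by move=> Y v; have [u Su] := rt' Y v; have [s Rs] := rt Y u; exists s, u.
- move=> Y Z s s' v v' h [u Ru Su] [u' Ru' Su'].
  by rewrite (RP _ _ _ _ _ _ h Ru Ru') (SP _ _ _ _ _ _ h Su Su').
Qed.

(** A round trip may change the hidden sort, so it returns to the original structure only in the
    sense that the identity of [Y] is a homomorphism both ways. *)
Lemma interdefinableI (T U : theory) (t : forall Y, str T Y -> str U Y)
    (t' : forall Y, str U Y -> str T Y) :
  (forall Y Z (s : str T Y) (s' : str T Z) h, hom s s' h -> hom (t Y s) (t Z s') h) ->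
  (forall Y Z (s : str U Y) (s' : str U Z) h, hom s s' h -> hom (t' Y s) (t' Z s') h) ->
  (forall Y s, hom (t' Y (t Y s)) s id /\ hom s (t' Y (t Y s)) id) ->
  (forall Y s, hom (t Y (t' Y s)) s id /\ hom s (t Y (t' Y s)) id) ->
  interdefinable T U.
Proof.
move=> th th' K K'.
exists (fun Y s u => hom (t Y s) u id /\ hom u (t Y s) id); split.
- by move=> Y s; exists (t Y s); split; exact: hom_id.
- by move=> Y u; exists (t' Y u); exact: K'.
- move=> Y Z s s' u u' h [su us] [su' us']; split=> H.
    exact: hom_comp us (hom_comp (th _ _ _ _ _ H) su').
  have H2 := hom_comp su (hom_comp H us').
  have [[_ k1] [k2 _]] := (K _ s, K _ s').
  exact: hom_comp k1 (hom_comp (th' _ _ _ _ _ H2) k2).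
Qed.

(* bijections X = X^A * Y^P and Y = X^B * Y^D, with X a hidden sort *)
Record str2 (A P B D Y : Type) := Str2 {
  sX : Type;
  xa : sX -> A -> sX; xp : sX -> P -> Y; xj : (A -> sX) -> (P -> Y) -> sX;
  yb : Y -> B -> sX; yd : Y -> D -> Y; yj : (B -> sX) -> (D -> Y) -> Y;
  xjA : forall u v a, xa (xj u v) a = u a;
  xjP : forall u v p, xp (xj u v) p = v p;
  x_ext : forall x x', (forall a, xa x a = xa x' a) ->
    (forall p, xp x p = xp x' p) -> x = x';
  yjB : forall u v b, yb (yj u v) b = u b;
  yjD : forall u v d, yd (yj u v) d = v d;
  y_ext : forall y y', (forall b, yb y b = yb y' b) ->
    (forall d, yd y d = yd y' d) -> y = y'
}.

Definition hom2 A P B D Y Z (s : str2 A P B D Y) (t : str2 A P B D Z) (h : Y -> Z) :=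
  exists k : sX s -> sX t,
    [/\ forall x a, k (xa x a) = xa (k x) a, forall x p, h (xp x p) = xp (k x) p,
        forall y b, k (yb s y b) = yb t (h y) b &
        forall y d, h (yd s y d) = yd t (h y) d].

Definition theory2 (A P B D : Type) : theory.
Proof.
refine (@Theory (str2 A P B D) (@hom2 A P B D) _ _).
  by move=> Y s; exists id.
move=> Y Z W s t u f g [k [k1 k2 k3 k4]] [l [l1 l2 l3 l4]].
by exists (l \o k); split=> *; rewrite /= ?k1 ?k2 ?k3 ?k4.
Defined.

Definition split_sum A B C (f : A -> C) (g : B -> C) (x : A + B) : C :=
  match x with inl a => f a | inr b => g b end.
Definition split_opt A C (c : C) (f : A -> C) (x : option A) : C :=
  if x is Some a then f a else c.

Section Reindex.
Variables A P B D A' P' B' D' : Type.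
Variables (fA : A' -> A) (gA : A -> A') (fP : P' -> P) (gP : P -> P').
Variables (fB : B' -> B) (gB : B -> B') (fD : D' -> D) (gD : D -> D').
Hypotheses (fAK : cancel fA gA) (gAK : cancel gA fA).
Hypotheses (fPK : cancel fP gP) (gPK : cancel gP fP).
Hypotheses (fBK : cancel fB gB) (gBK : cancel gB fB).
Hypotheses (fDK : cancel fD gD) (gDK : cancel gD fD).

Definition reindex2 Y (s : str2 A P B D Y) : str2 A' P' B' D' Y.
Proof.
refine (@Str2 A' P' B' D' Y (sX s) (fun x a => xa x (fA a)) (fun x p => xp x (fP p))
  (fun u v => xj (u \o gA) (v \o gP)) (fun y b => yb s y (fB b)) (fun y d => yd s y (fD d))
  (fun u v => yj (u \o gB) (v \o gD)) _ _ _ _ _ _).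
- by move=> u v a; rewrite xjA /= fAK.
- by move=> u v p; rewrite xjP /= fPK.
- move=> x x' ea ep; apply: x_ext => [a|p]; first by have := ea (gA a); rewrite gAK.
  by have := ep (gP p); rewrite gPK.
- by move=> u v b; rewrite yjB /= fBK.
- by move=> u v d; rewrite yjD /= fDK.
- move=> y y' eb ed; apply: (@y_ext _ _ _ _ _ s) => [b|d]; first by have := eb (gB b); rewrite gBK.
  by have := ed (gD d); rewrite gDK.
Defined.

End Reindex.


Lemma interdefinable_reindex A P B D A' P' B' D' (fA : A' -> A) (fP : P' -> P)
    (fB : B' -> B) (fD : D' -> D) :
  bijective fA -> bijective fP -> bijective fB -> bijective fD ->
  interdefinable (theory2 A P B D) (theory2 A' P' B' D').
Proof.
move=> [gA fAK gAK] [gP fPK gPK] [gB fBK gBK] [gD fDK gDK].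
apply: (@interdefinableI (theory2 A P B D) (theory2 A' P' B' D')
  (reindex2 fAK gAK fPK gPK fBK gBK fDK gDK)
  (reindex2 gAK fAK gPK fPK gBK fBK gDK fDK)).
- by move=> Y Z s s' h [k [k1 k2 k3 k4]]; exists k; split=> *; rewrite /= ?k1 ?k2 ?k3 ?k4.
- by move=> Y Z s s' h [k [k1 k2 k3 k4]]; exists k; split=> *; rewrite /= ?k1 ?k2 ?k3 ?k4.
- by move=> Y s; split; exists id; split=> *; rewrite /= ?gAK ?gPK ?gBK ?gDK.
- by move=> Y s; split; exists id; split=> *; rewrite /= ?fAK ?fPK ?fBK ?fDK.
Qed.

Section Moves.
Variables A P B D : Type.

(* substituting Y = X^B * Y^D for one factor of X = X^A * Y * Y^P *)
Definition expandX Y (s : str2 A (option P) B D Y) : str2 (A + B) (P + D) B D Y.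
Proof.
refine (@Str2 (A + B) (P + D) B D Y (sX s)
  (fun x => split_sum (xa x) (yb s (xp x None)))
  (fun x => split_sum (fun p => xp x (Some p)) (yd s (xp x None)))
  (fun u v => xj (u \o inl) (split_opt (yj (u \o inr) (v \o inr)) (v \o inl)))
  (@yb _ _ _ _ _ s) (@yd _ _ _ _ _ s) (@yj _ _ _ _ _ s) _ _ _ _ _ _).
- by move=> u v [a|b] /=; rewrite ?xjA // xjP /= yjB.
- by move=> u v [p|d] /=; rewrite xjP //= yjD.
- move=> x x' ea ep; apply: x_ext => [a|[p|]]; first exact: ea (inl a).
    exact: ep (inl p).
  by apply: y_ext => [b|d]; [exact: ea (inr b)|exact: ep (inr d)].
- exact: yjB.
- exact: yjD.
- exact: y_ext.
Defined.

Definition contractX Y (s : str2 (A + B) (P + D) B D Y) : str2 A (option P) B D Y.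
Proof.
refine (@Str2 A (option P) B D Y (sX s)
  (fun x a => xa x (inl a))
  (fun x => split_opt (yj (xa x \o inr) (xp x \o inr)) (fun p => xp x (inl p)))
  (fun u v => xj (split_sum u (yb s (v None)))
                 (split_sum (v \o Some) (yd s (v None))))
  (@yb _ _ _ _ _ s) (@yd _ _ _ _ _ s) (@yj _ _ _ _ _ s) _ _ _ _ _ _).
- by move=> u v a; rewrite xjA.
- move=> u v [p|] /=; first by rewrite xjP.
  by apply: (@y_ext _ _ _ _ _ s) => [b|d]; rewrite ?yjB ?yjD /= ?xjA ?xjP.
- move=> x x' ea ep; apply: x_ext => [[a|b]|[p|d]]; first exact: ea.
  + by have /(congr1 (fun y => yb s y b)) := ep None; rewrite /= !yjB.
  + exact: (ep (Some p)).
  + by have /(congr1 (fun y => yd s y d)) := ep None; rewrite /= !yjD.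
- exact: yjB.
- exact: yjD.
- exact: y_ext.
Defined.

Lemma interdefinable_expandX :
  interdefinable (theory2 A (option P) B D) (theory2 (A + B) (P + D) B D).
Proof.
apply: (@interdefinableI (theory2 A (option P) B D) (theory2 (A + B) (P + D) B D)
  expandX contractX).
- move=> Y Z s s' h [k [k1 k2 k3 k4]]; exists k; split=> //=.
    by move=> x [a|b] /=; rewrite ?k1 // k3 k2.
  by move=> x [p|d] /=; rewrite ?k4 k2.
- move=> Y Z s s' h [k [k1 k2 k3 k4]]; exists k; split=> //= x [p|] /=; first exact: k2.
  apply: (@y_ext _ _ _ _ _ s') => [b|d].
    by rewrite -k3 !yjB /= k1.
  by rewrite -k4 !yjD /= k2.
- move=> Y s; split; exists id; split=> //= x [p|] //=;
    by apply: (@y_ext _ _ _ _ _ s) => [b|d]; rewrite ?yjB ?yjD.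
- by move=> Y s; split; exists id; split=> //= x [p|d] //=; rewrite ?yjB ?yjD.
Qed.

(* substituting X = X^A * Y^P for one factor of Y = X * X^B * Y^D *)
Definition expandY Y (s : str2 A P (option B) D Y) : str2 A P (B + A) (D + P) Y.
Proof.
refine (@Str2 A P (B + A) (D + P) Y (sX s)
  (@xa _ _ _ _ _ s) (@xp _ _ _ _ _ s) (@xj _ _ _ _ _ s)
  (fun y => split_sum (fun b => yb s y (Some b)) (xa (yb s y None)))
  (fun y => split_sum (yd s y) (xp (yb s y None)))
  (fun u v => yj (split_opt (xj (u \o inr) (v \o inr)) (u \o inl)) (v \o inl)) _ _ _ _ _ _).
- exact: xjA.
- exact: xjP.
- exact: x_ext.
- by move=> u v [b|a] /=; rewrite yjB //= xjA.
- by move=> u v [d|p] /=; rewrite ?yjD // yjB /= xjP.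
- move=> y y' eb ed; apply: (@y_ext _ _ _ _ _ s) => [[b|]|d]; first exact: eb (inl b).
    by apply: x_ext => [a|p]; [exact: eb (inr a)|exact: ed (inr p)].
  exact: ed (inl d).
Defined.

Definition contractY Y (s : str2 A P (B + A) (D + P) Y) : str2 A P (option B) D Y.
Proof.
refine (@Str2 A P (option B) D Y (sX s)
  (@xa _ _ _ _ _ s) (@xp _ _ _ _ _ s) (@xj _ _ _ _ _ s)
  (fun y => split_opt (xj (yb s y \o inr) (yd s y \o inr)) (fun b => yb s y (inl b)))
  (fun y d => yd s y (inl d))
  (fun u v => yj (split_sum (u \o Some) (xa (u None))) (split_sum v (xp (u None)))) _ _ _ _ _ _).
- exact: xjA.
- exact: xjP.
- exact: x_ext.
- move=> u v [b|] /=; first by rewrite yjB.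
  by apply: (@x_ext _ _ _ _ _ s) => [a|p]; rewrite ?xjA ?xjP /= ?yjB ?yjD.
- by move=> u v d; rewrite yjD.
- move=> y y' eb ed; apply: (@y_ext _ _ _ _ _ s) => [[b|a]|[d|p]].
  + exact: (eb (Some b)).
  + by have /(congr1 (fun x => xa x a)) := eb None; rewrite /= !xjA.
  + exact: ed.
  + by have /(congr1 (fun x => xp x p)) := eb None; rewrite /= !xjP.
Defined.

Lemma interdefinable_expandY :
  interdefinable (theory2 A P (option B) D) (theory2 A P (B + A) (D + P)).
Proof.
apply: (@interdefinableI (theory2 A P (option B) D) (theory2 A P (B + A) (D + P))
  expandY contractY).
- move=> Y Z s s' h [k [k1 k2 k3 k4]]; exists k; split=> //=.
    by move=> y [b|a] /=; rewrite ?k1 k3.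
  by move=> y [d|p] /=; rewrite ?k4 // k2 k3.
- move=> Y Z s s' h [k [k1 k2 k3 k4]]; exists k; split=> //= y.
  move=> [b|] /=; first exact: k3.
  apply: (@x_ext _ _ _ _ _ s') => [a|p].
    by rewrite -k1 !xjA /= k3.
  by rewrite -k2 !xjP /= k4.
- move=> Y s; split; exists id; split=> //= y [b|] //=;
    by apply: (@x_ext _ _ _ _ _ s) => [a|p]; rewrite ?xjA ?xjP.
- by move=> Y s; split; exists id; split=> //= y [b|a] //=; rewrite ?xjA ?xjP.
Qed.

(* changing the hidden sort: X = X' * Y with X' = X^A * Y^P *)
Section ChangeX.
Variable Y : Type.

Let pack (s : str2 A (option P) B D Y) (w : ((A -> sX s) * (P -> Y)) * Y) : sX s :=
  xj w.1.1 (split_opt w.2 w.1.2).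
Let rest (s : str2 A (option P) B D Y) (x : sX s) : (A -> sX s) * (P -> Y) :=
  (xa x, fun p => xp x (Some p)).

Let packK s w : (rest (@pack s w), xp (@pack s w) None) = w.
Proof.
case: w => [[u v] y]; rewrite /rest /pack /= xjP /=; congr (_, _, _).
  by apply/funext => a; rewrite xjA.
by apply/funext => p; rewrite xjP.
Qed.

Let restK s x : @pack s (@rest s x, xp x None) = x.
Proof. by apply: x_ext => [a|[p|]]; rewrite ?xjA ?xjP. Qed.

Definition shrinkX (s : str2 A (option P) B D Y) : str2 A (P + A) B (D + B) Y.
Proof.
refine (@Str2 A (P + A) B (D + B) Y ((A -> sX s) * (P -> Y))%type
  (fun x a => rest (x.1 a))
  (fun x => split_sum x.2 (fun a => xp (x.1 a) None))
  (fun u v => (fun a => pack (u a, v (inr a)), fun p => v (inl p)))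
  (fun y b => rest (yb s y b))
  (fun y => split_sum (yd s y) (fun b => xp (yb s y b) None))
  (fun u v => yj (fun b => pack (u b, v (inr b))) (v \o inl)) _ _ _ _ _ _).
- by move=> u v a; have [] := packK (u a, v (inr a)).
- by move=> u v [p|a] //=; have /(congr1 snd) := packK (u a, v (inr a)).
- move=> [u v] [u' v'] /= ea ep; congr (_, _).
    by apply/funext => a; have /= e := ep (inr a); rewrite -(restK (u a)) -(restK (u' a)) ea e.
  by apply/funext => p; exact: (ep (inl p)).
- by move=> u v b; rewrite yjB; have /(congr1 fst) := packK (u b, v (inr b)).
- move=> u v [d|b] /=; rewrite ?yjD // yjB.
  by have /(congr1 snd) := packK (u b, v (inr b)).
- move=> y y' eb ed; apply: (@y_ext _ _ _ _ _ s) => [b|d]; last exact: (ed (inl d)).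
  by have /= e := ed (inr b); rewrite -(restK (yb s y b)) -(restK (yb s y' b)) eb e.
Defined.

Definition growX (s : str2 A (P + A) B (D + B) Y) : str2 A (option P) B D Y.
Proof.
refine (@Str2 A (option P) B D Y (sX s * Y)%type
  (fun x a => (xa x.1 a, xp x.1 (inr a)))
  (fun x => split_opt x.2 (fun p => xp x.1 (inl p)))
  (fun u v => (xj (fun a => (u a).1) (split_sum (v \o Some) (fun a => (u a).2)), v None))
  (fun y b => (yb s y b, yd s y (inr b)))
  (fun y d => yd s y (inl d))
  (fun u v => yj (fun b => (u b).1) (split_sum v (fun b => (u b).2))) _ _ _ _ _ _).
- by move=> u v a /=; rewrite xjA xjP /=; case: (u a).
- by move=> u v [p|] //=; rewrite xjP.
- move=> [x y] [x' y'] /= ea ep; have /= -> := ep None; congr (_, _).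
  apply: x_ext => [a|[p|a]]; first by case: (ea a).
    exact: (ep (Some p)).
  by case: (ea a).
- by move=> u v b /=; rewrite yjB yjD /=; case: (u b).
- by move=> u v d /=; rewrite yjD.
- move=> y y' eb ed; apply: (@y_ext _ _ _ _ _ s) => [b|[d|b]]; first by case: (eb b).
    exact: ed.
  by case: (eb b).
Defined.

Lemma grow_shrinkX s : hom2 (growX (shrinkX s)) s id /\ hom2 s (growX (shrinkX s)) id.
Proof.
split; [exists (@pack s)|exists (fun x => (rest x, xp x None))]; split=> //=.
- move=> x a; have -> : xa (pack x) a = x.1.1 a by rewrite /pack xjA.
  exact: restK.
- by move=> x [p|] /=; rewrite /pack xjP.
- by move=> x [p|].
Qed.

Lemma shrink_growX s : hom2 (shrinkX (growX s)) s id /\ hom2 s (shrinkX (growX s)) id.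
Proof.
split.
  exists (fun x => xj (fun a => (x.1 a).1) (split_sum x.2 (fun a => (x.1 a).2))).
  split=> //=.
  - move=> x a; rewrite xjA; apply: x_ext => [b|[p|b]]; rewrite ?xjA ?xjP //=.
  - by move=> x [p|a] /=; rewrite xjP.
  - by move=> y b; apply: x_ext => [c|[p|c]]; rewrite ?xjA ?xjP.
  - by move=> y [d|b].
exists (fun x => (fun a => (xa x a, xp x (inr a)), fun p => xp x (inl p))).
by split=> //= x [p|a].
Qed.

End ChangeX.

Lemma interdefinable_shrinkX :
  interdefinable (theory2 A (option P) B D) (theory2 A (P + A) B (D + B)).
Proof.
apply: (@interdefinableI (theory2 A (option P) B D) (theory2 A (P + A) B (D + B))
  shrinkX growX).
- move=> Y Z s s' h [k [k1 k2 k3 k4]].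
  exists (fun x => (fun a => k (x.1 a), fun p => h (x.2 p))); split=> /=.
  + by move=> x a; congr (_, _); apply/funext => c; rewrite ?k1 ?k2.
  + by move=> x [p|a] //=; rewrite k2.
  + by move=> y b; congr (_, _); apply/funext => c; rewrite ?k1 ?k2 k3.
  + by move=> y [d|b] /=; rewrite ?k4 // k2 k3.
- move=> Y Z s s' h [k [k1 k2 k3 k4]].
  exists (fun x => (k x.1, h x.2)); split=> //=.
  + by move=> x a; rewrite k1 k2.
  + by move=> x [p|] //=; rewrite k2.
  + by move=> y b; rewrite k3 k4.
- exact: grow_shrinkX.
- exact: shrink_growX.
Qed.

End Moves.

(* Jonsson-Tarski algebras Y = Y^A *)
Record jt (A Y : Type) := JT {
  jsp : Y -> A -> Y; jj : (A -> Y) -> Y;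
  jjE : forall u a, jsp (jj u) a = u a;
  j_ext : forall y y', (forall a, jsp y a = jsp y' a) -> y = y'
}.

Definition homj A Y Z (s : jt A Y) (t : jt A Z) (h : Y -> Z) :=
  forall y a, h (jsp s y a) = jsp t (h y) a.

Definition jt_theory (A : Type) : theory.
Proof.
refine (@Theory (jt A) (@homj A) _ _) => //.
by move=> Y Z W s t u f g fh gh y a; rewrite /= fh gh.
Defined.

Section EliminateX.
Variables P B D : Type.

(** With no factor X on its right side, the first equation reads X = Y^P; substituting it into the
    second one leaves Y = Y^(B * P + D). *)
Definition elimX Y (s : str2 void P B D Y) : jt (B * P + D) Y.
Proof.
refine (@JT (B * P + D) Y
  (fun y => split_sum (fun bp => xp (yb s y bp.1) bp.2) (yd s y))
  (fun u => yj (fun b => xj (of_void (sX s)) (fun p => u (inl (b, p)))) (u \o inr))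
  _ _).
- by move=> u [[b p]|d] /=; rewrite ?yjD // yjB xjP.
- move=> y y' e; apply: (@y_ext _ _ _ _ _ s) => [b|d]; last exact: (e (inr d)).
  by apply: x_ext => [[]|p]; exact: (e (inl (b, p))).
Defined.

Definition introX Y (s : jt (B * P + D) Y) : str2 void P B D Y.
Proof.
refine (@Str2 void P B D Y (P -> Y) (fun x => of_void _) (fun x => x)
  (fun _ v => v) (fun y b p => jsp s y (inl (b, p))) (fun y d => jsp s y (inr d))
  (fun u v => jj s (split_sum (fun bp => u bp.1 bp.2) v)) _ _ _ _ _ _) => //.
- by move=> x x' _ e; apply/funext.
- by move=> u v b; apply/funext => p; rewrite jjE.
- by move=> u v d; rewrite jjE.
- move=> y y' eb ed; apply: (@j_ext _ _ s) => -[[b p]|d]; last exact: ed.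
  by have /funeqP := eb b.
Defined.

Lemma interdefinable_elimX :
  interdefinable (theory2 void P B D) (jt_theory (B * P + D)).
Proof.
apply: (@interdefinableI (theory2 void P B D) (jt_theory (B * P + D)) elimX introX).
- move=> Y Z s s' h [k [k1 k2 k3 k4]] y [[b p]|d] /=; last exact: k4.
  by rewrite k2 k3.
- move=> Y Z s s' h hh; exists (fun x p => h (x p)); split=> //= y b.
  by apply/funext => p; exact: hh.
- move=> Y s; split.
    exists (fun x : P -> Y => xj (of_void _) x).
    split=> //= [x p|y b]; rewrite ?xjP //.
    by apply: x_ext => [[]|p]; rewrite xjP.
  by exists (fun x => xp x); split=> //= x [].
- by move=> Y s; split=> y [[b p]|d].
Qed.

End EliminateX.

Lemma interdefinable_jt_reindex A A' (f : A' -> A) : bijective f ->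
  interdefinable (jt_theory A) (jt_theory A').
Proof.
move=> [g fK gK].
have mk B B' (f' : B' -> B) (g' : B -> B') Y (s : jt B Y) : cancel f' g' -> cancel g' f' ->
    {t : jt B' Y | forall y b, jsp t y b = jsp s y (f' b)}.
  move=> fK' gK'; unshelve eexists.
    refine (@JT B' Y (fun y b => jsp s y (f' b)) (fun u => jj s (u \o g')) _ _).
      by move=> u b; rewrite jjE /= fK'.
    by move=> y y' e; apply: (@j_ext _ _ s) => b; have := e (g' b); rewrite gK'.
  by [].
have E B B' f' g' Y s cf cg y b :
    jsp (sval (mk B B' f' g' Y s cf cg)) y b = jsp s y (f' b) by exact: svalP (mk _ _ _ _ _ _ _ _) y b.
apply: (@interdefinableI (jt_theory A) (jt_theory A') (fun Y s => sval (mk _ _ f g Y s fK gK))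
  (fun Y s => sval (mk _ _ g f Y s gK fK))).
- by move=> Y Z s s' h hh y a; rewrite !E.
- by move=> Y Z s s' h hh y a; rewrite !E.
- by move=> Y s; split=> y a; rewrite !E gK.
- by move=> Y s; split=> y a; rewrite !E fK.
Qed.

Lemma card_eq_bij (S T : finType) : #|S| = #|T| -> exists f : S -> T, bijective f.
Proof.
move=> e; exists (fun x => enum_val (cast_ord e (enum_rank x))).
exists (fun y => enum_val (cast_ord (esym e) (enum_rank y))) => x.
  by rewrite enum_valK cast_ordK enum_rankK.
by rewrite enum_valK cast_ordKV enum_rankK.
Qed.

Lemma interdefinable_card (A P B D A' P' B' D' : finType) :
  #|A'| = #|A| -> #|P'| = #|P| -> #|B'| = #|B| -> #|D'| = #|D| ->
  interdefinable (theory2 A P B D) (theory2 A' P' B' D').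
Proof.
move=> /card_eq_bij[fA bA] /card_eq_bij[fP bP] /card_eq_bij[fB bB] /card_eq_bij[fD bD].
exact: interdefinable_reindex bA bP bB bD.
Qed.

Definition ord_theory (al p b de : nat) : theory := theory2 'I_al 'I_p 'I_b 'I_de.

Definition card_finE := (card_sum, card_prod, card_option, card_void, card_ord).

Lemma ord_expandX al p b de :
  interdefinable (ord_theory al p.+1 b de) (ord_theory (al + b) (p + de) b de).
Proof.
apply: (@interdefinable_trans _ (theory2 'I_al (option 'I_p) 'I_b 'I_de)).
  by apply: interdefinable_card; rewrite ?card_finE.
apply: interdefinable_trans (interdefinable_expandX _ _ _ _) _.
by apply: interdefinable_card; rewrite ?card_finE.
Qed.

Lemma ord_expandY al p b de :
  interdefinable (ord_theory al p b.+1 de) (ord_theory al p (b + al) (de + p)).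
Proof.
apply: (@interdefinable_trans _ (theory2 'I_al 'I_p (option 'I_b) 'I_de)).
  by apply: interdefinable_card; rewrite ?card_finE.
apply: interdefinable_trans (interdefinable_expandY _ _ _ _) _.
by apply: interdefinable_card; rewrite ?card_finE.
Qed.

Lemma ord_shrinkX al p b de :
  interdefinable (ord_theory al p.+1 b de) (ord_theory al (p + al) b (de + b)).
Proof.
apply: (@interdefinable_trans _ (theory2 'I_al (option 'I_p) 'I_b 'I_de)).
  by apply: interdefinable_card; rewrite ?card_finE.
apply: interdefinable_trans (interdefinable_shrinkX _ _ _ _) _.
by apply: interdefinable_card; rewrite ?card_finE.
Qed.

Lemma ord_elimX p b de :
  interdefinable (ord_theory 0 p b de) (jt_theory 'I_(b * p + de)).
Proof.
apply: (@interdefinable_trans _ (theory2 void 'I_p 'I_b 'I_de)).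
  by apply: interdefinable_card; rewrite ?card_finE.
apply: interdefinable_trans (interdefinable_elimX _ _ _) _.
have [|f bf] := @card_eq_bij 'I_(b * p + de) ('I_b * 'I_p + 'I_de)%type.
  by rewrite !card_finE.
exact: interdefinable_jt_reindex bf.
Qed.

(* p * b - a * q = N is, up to sign, the determinant of the relation matrix    *)
(* (identity minus exponents), which every move preserves                      *)
Lemma ord_theory_shift a p b q k : 0 < p ->
  interdefinable (ord_theory a.+1 p b q.+1)
                 (ord_theory a.+1 (p + k * a) b (q + k * b).+1).
Proof.
move=> p0; elim: k => [|k IH]; first by rewrite !mul0n !addn0; exact: interdefinable_refl.
apply: interdefinable_trans IH _.
have := ord_shrinkX a.+1 (p + k * a).-1 b (q + k * b).+1.
rewrite prednK ?addn_gt0 ?p0 // => H.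
have -> : p + k.+1 * a = (p + k * a).-1 + a.+1 by rewrite mulSn; lia.
by have -> : (q + k.+1 * b).+1 = (q + k * b).+1 + b by rewrite mulSn; lia.
Qed.

(** The subtractive Euclidean algorithm on [a] and [b]: undoing [ord_expandX] replaces [a] by
    [a - b], undoing [ord_expandY] replaces [b] by [b - a]. Coprimality leads to a = b = 1, where X
    can be eliminated; the preserved determinant makes the final arity N+1. *)
Lemma ord_theory_jt N a p b q : 0 < N -> 0 < a -> 0 < b -> coprime a b ->
  p * b = a * q + N -> interdefinable (ord_theory a.+1 p b q.+1) (jt_theory 'I_N.+1).
Proof.
move=> N0; have [m] := ubnP (a + b); elim: m a p b q => // m IH a p b q.
move=> lt a0 b0 co e.
have p0 : 0 < p by case: p e => //; rewrite mul0n; lia.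
case: (ltngtP a b) => ab.
(* Undoing [ord_expandY] takes [p] away from the exponent [q.+1], which must stay positive. As a <
   b, shifting increases [q] faster than [p], and [p] shifts suffice. *)
- apply: interdefinable_trans (ord_theory_shift a b q p p0) _.
  set p' := p + p * a; set q' := q + p * b.
  have pq : p' <= q' by rewrite /p' /q'; nia.
  have := ord_expandY a.+1 p' (b - a).-1 (q' - p').+1.
  have -> : (b - a).-1.+1 = b - a by lia.
  have -> : (b - a).-1 + a.+1 = b by lia.
  have -> : (q' - p').+1 + p' = q'.+1 by lia.
  move=> /interdefinable_sym H; apply: interdefinable_trans H _.
  apply: IH => //; first by lia.
  + by rewrite subn_gt0.
  + move: co; rewrite -{1}(subnKC (ltnW ab)) /coprime.
    by rewrite gcdnDl.
  + rewrite mulnBr mulnBr; rewrite /p' /q' in pq *; nia.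
- have pq : q < p by nia.
  have := ord_expandX (a - b).+1 (p - q).-1 b q.+1.
  have -> : (p - q).-1.+1 = p - q by lia.
  have -> : (p - q).-1 + q.+1 = p by lia.
  have -> : (a - b).+1 + b = a.+1 by lia.
  move=> /interdefinable_sym H; apply: interdefinable_trans H _.
  apply: IH => //; first by lia.
  + by rewrite subn_gt0.
  + move: co; rewrite -{1}(subnKC (ltnW ab)) /coprime.
    by rewrite gcdnC gcdnDl gcdnC.
  + by rewrite mulnBl mulnBl; nia.
(* From exponents 2, N+q, 1, q+1, undo [q] shifts to reach 2, N, 1, 1; undoing [ord_expandX] twice
   then lowers the first exponent to 0. *)
- subst b; have a1 : a = 1 by move: co; rewrite /coprime gcdnn => /eqP.
  subst a; have -> : p = N + q by lia.
  have := ord_theory_shift 1 1 0 q N0; rewrite add0n !muln1.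
  move=> /interdefinable_sym H; apply: interdefinable_trans H _.
  have := ord_expandX 1 N.-1 1 1; rewrite !addn1 !prednK // => /interdefinable_sym H.
  apply: interdefinable_trans H _.
  have := ord_expandX 0 N.-1 1 1; rewrite !addn1 !prednK // => /interdefinable_sym H.
  apply: interdefinable_trans H _.
  by have := ord_elimX N 1 1; rewrite mul1n addn1.
Qed.

(** Starting from X = X^n and Y = X^d, fold [d] factors into one Y, which gives X = X^(n-d) * Y, and
    change X to get X = X^(n-d) * Y^(n-d), Y = X^d * Y^d. The determinant condition is (n-d) * d =
    (n-1-d) * (d-1) + (n-1), and n-1-d is prime to [d]. *)
Lemma power_theory_jt n d : 0 < d -> d < n.-1 -> coprime d n.-1 ->
  interdefinable (ord_theory n 0 d 0) (jt_theory 'I_n).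
Proof.
move=> d0 dn co.
have := ord_expandX (n - d) 0 d 0; rewrite subnK ?add0n; last by lia.
move=> /interdefinable_sym H; apply: interdefinable_trans H _.
apply: interdefinable_trans (ord_shrinkX _ _ _ _) _; rewrite !add0n.
have := @ord_theory_jt n.-1 (n.-1 - d) (n - d) d d.-1.
have -> : (n.-1 - d).+1 = n - d by lia.
rewrite !prednK //; last by lia.
apply => //; try by lia.
- move: co; rewrite -{1}(subnKC (ltnW dn)) /coprime.
  by rewrite gcdnDl gcdnC.
- have [e ->] : exists e, n = d + e.+2 by exists (n - d - 2); lia.
  case: d d0 {co dn} => // d _ /=.
  have -> : (d.+1 + e.+2).-1 - d.+1 = e.+1 by lia.
  have -> : d.+1 + e.+2 - d.+1 = e.+2 by lia.
  nia.
Qed.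

(** * Free Jonsson-Tarski algebras *)

Definition free T Y (s : str T Y) r (e : 'I_r -> Y) : Prop :=
  forall Z (t : str T Z) (f : 'I_r -> Z), exists h,
    [/\ hom s t h, forall i, h (e i) = f i &
        forall h', hom s t h' -> (forall i, h' (e i) = f i) -> h' = h].

Lemma free_iso T Y Z (s : str T Y) (t : str T Z) r (e : 'I_r -> Y) (e' : 'I_r -> Z) :
  free s e -> free t e' -> exists j j',
    [/\ cancel j j', cancel j' j, hom s t j & hom t s j'].
Proof.
move=> fs ft.
have [j [hj je _]] := fs _ t e'; have [j' [hj' je' _]] := ft _ s e.
exists j, j'; split=> // x.
  have [h [_ _ uh]] := fs _ s e.
  have E1 := uh _ (hom_comp hj hj') (fun i => etrans (congr1 j' (je i)) (je' i)).
  have E2 := uh _ (hom_id s) (fun i => erefl).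
  by have /funeqP/(_ x) := etrans E1 (esym E2).
have [h [_ _ uh]] := ft _ t e'.
have E1 := uh _ (hom_comp hj' hj) (fun i => etrans (congr1 j (je' i)) (je i)).
have E2 := uh _ (hom_id t) (fun i => erefl).
by have /funeqP/(_ x) := etrans E1 (esym E2).
Qed.

(* anti-multiplicative, because higman_thompson acts on the right *)
Definition aut_rep (G : groupType) T Y (s : str T Y) : Prop :=
  exists rh : G -> Y -> Y,
    [/\ forall g h y, rh (g * h)%g y = rh h (rh g y), forall y, rh 1%g y = y,
        forall g, hom s s (rh g), forall g h, rh g =1 rh h -> g = h &
        forall u u', cancel u u' -> cancel u' u -> hom s s u -> hom s s u' ->
          exists g, rh g = u].

Lemma aut_rep_iso (G H : groupType) T Y (s : str T Y) :
  aut_rep G s -> aut_rep H s -> group_isomorphic G H.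
Proof.
move=> [a [aM a1 ah ai as_]] [b [bM b1 bh bi bs]].
have aK g : cancel (a g) (a g^-1%g) by move=> y; rewrite -aM mulgV a1.
have aVK g : cancel (a g^-1%g) (a g) by move=> y; rewrite -aM mulVg a1.
have bK g : cancel (b g) (b g^-1%g) by move=> y; rewrite -bM mulgV b1.
have bVK g : cancel (b g^-1%g) (b g) by move=> y; rewrite -bM mulVg b1.
have /choice[f fP] g : exists h, b h = a g by exact: bs (aK g) (aVK g) (ah _) (ah _).
have /choice[f' f'P] h : exists g, a g = b h by exact: as_ (bK h) (bVK h) (bh _) (bh _).
have fM : {morph f : x y / (x * y)%g}.
  by move=> x y; apply: bi => z; rewrite bM !fP aM.
pose fm : {multiplicative G -> H} := HB.pack f (isMultiplicative.Build _ _ f fM).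
exists fm, f' => x /=.
  by apply: ai => y; rewrite f'P fP.
by apply: bi => y; rewrite fP f'P.
Qed.

Lemma aut_rep_conj G T Y Z (s : str T Y) (t : str T Z) j j' : cancel j j' ->
  cancel j' j -> hom s t j -> hom t s j' -> aut_rep G s -> aut_rep G t.
Proof.
move=> jK j'K hj hj' [a [aM a1 ah ai as_]].
exists (fun g => j \o (a g \o j')); split.
- by move=> g h y /=; rewrite jK aM.
- by move=> y /=; rewrite a1.
- by move=> g; exact: hom_comp (hom_comp hj' (ah g)) hj.
- move=> g h e; apply: ai => y; have := e (j y); rewrite /= jK => /(can_inj jK) //.
- move=> u u' uK u'K hu hu'.
  have [||||g eg] := as_ (j' \o (u \o j)) (j' \o (u' \o j)).
  + by move=> y; rewrite /= j'K uK.
  + by move=> y; rewrite /= j'K u'K.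
  + exact: hom_comp (hom_comp hj hu) hj'.
  + exact: hom_comp (hom_comp hj hu') hj'.
  by exists g; apply/funext => y; rewrite eg /= !j'K.
Qed.

Lemma aut_rep_interdef G T U Y (s : str T Y) (t : str U Y) :
  (forall h, hom s s h <-> hom t t h) -> aut_rep G s -> aut_rep G t.
Proof.
move=> H [a [aM a1 ah ai as_]]; exists a; split=> // [g|u u' uK u'K].
  exact/H.
by rewrite -!H; exact: as_ uK u'K.
Qed.

Section FreeAlgebra.
Variables (n r : nat) (n2 : 2 <= n).
Implicit Types (z : iword n) (w : seq 'I_n).

Definition local_at N (f : iword n -> point n r) : Prop :=
  forall w, size w = N -> exists v, forall z, f (app w z) = ev v z.
(** The free algebra is realised by the piecewise prefix maps from infinite words to points;
    restricting such a map to the n cones of first letters gives the bijection Y = Y^n. *)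
Definition jt_free : Type := {f : iword n -> point n r | exists N, local_at N f}.

Implicit Types f g : iword n -> point n r.

Lemma jt_free_eq (x y : jt_free) : sval x = sval y -> x = y.
Proof. by case: x y => [f lf] [g lg] /= e; exact: eq_exist. Qed.

Lemma local_atS N f : local_at N f -> forall M, N <= M -> local_at M f.
Proof.
move=> lf M NM w sw; have [|v fv] := lf (take N w); first by rewrite size_takel ?sw.
exists (xact v (drop N w)) => z.
by rewrite -{1}(cat_take_drop N w) app_cat fv ev_act.
Qed.

Definition scons (a : 'I_n) z : iword n := app [:: a] z.
Definition stail z : iword n := fun i => z i.+1.

Lemma scons_tail z : scons (z 0) (stail z) = z.
Proof. by apply/funext => -[|i] //=; rewrite /scons /app /stail /= nth_nil subn1. Qed.

Lemma scons0 a z : scons a z 0 = a. Proof. by []. Qed.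

Lemma stail_cons a z : stail (scons a z) = z.
Proof. by apply/funext => i; rewrite /scons /app /stail /= nth_nil subn1. Qed.

Lemma app_cons a w z : app (a :: w) z = scons a (app w z).
Proof. by rewrite -cat1s app_cat. Qed.

Lemma local_scons N f a : local_at N.+1 f -> local_at N (f \o scons a).
Proof.
move=> lf w sw; have [|v fv] := lf (a :: w); first by rewrite /= sw.
by exists v => z; rewrite /= -app_cons.
Qed.

Lemma local_join N (f : 'I_n -> iword n -> point n r) : (forall a, local_at N (f a)) ->
  local_at N.+1 (fun z => f (z 0) (stail z)).
Proof.
move=> lf [//|a w] [sw]; have [v fv] := lf a w sw.
by exists v => z; rewrite app_cons scons0 stail_cons.
Qed.

Definition jt_free_algebra : jt 'I_n jt_free.
Proof.
unshelve refine (@JT 'I_n jt_free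
  (fun x a => exist _ (sval x \o scons a) _)
  (fun u => exist _ (fun z => sval (u (z 0)) (stail z)) _) _ _).
- case: x => f [N lf] /=; exists N; apply: local_scons; exact: local_atS lf _ _.
- have /choice[N lN] : forall a, exists N, local_at N (sval (u a)) by move=> a; case: (u a).
  exists (\max_a N a).+1; apply: (@local_join _ (fun a => sval (u a))) => a.
  by apply: local_atS (lN a) _ _; exact: leq_bigmax.
- by move=> u a; apply: jt_free_eq; apply/funext => z /=; rewrite scons0 stail_cons.
- move=> [f lf] [g lg] e; apply: jt_free_eq; apply/funext => z.
  by have /(congr1 sval)/funeqP/(_ (stail z)) := e (z 0); rewrite /= scons_tail.
Defined.

Lemma local_gen (i : 'I_r) : local_at 0 (fun z => (i, z) : point n r).
Proof. by move=> w /size0nil ->; exists (i, [::]) => z; rewrite /ev /= !app0. Qed.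

Definition jt_gen (i : 'I_r) : jt_free :=
  exist _ (fun z => (i, z) : point n r) (ex_intro _ 0 (@local_gen i)).

Section Universal.
Variables (Z : Type) (t : jt 'I_n Z) (s : 'I_r -> Z).

Definition descend (y : Z) w : Z := foldl (jsp t) y w.
Definition value (v : xword n r) : Z := descend (s v.1) v.2.

Lemma value_xact v w : value (xact v w) = descend (value v) w.
Proof. by rewrite /value /descend foldl_cat. Qed.

Lemma descend_inj N y y' : (forall w, size w = N -> descend y w = descend y' w) -> y = y'.
Proof.
elim: N y y' => [|N IH] y y' e; first exact: (e [::]).
by apply: (@j_ext _ _ t) => a; apply: IH => w sw; apply: (e (a :: w)); rewrite /= sw.
Qed.

(** The graph of the homomorphism extending [s], at depth [N]: on each word of length [N] the map
    [f] has a prefix [v], which prescribes the corresponding component of [y]. By [evaluates_uniq]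
    the depth does not affect [y]. *)
Definition evaluates N f y : Prop :=
  forall w, size w = N -> exists v, (forall z, f (app w z) = ev v z) /\
    descend y w = value v.

Lemma evaluates_ex N f : local_at N f -> exists y, evaluates N f y.
Proof.
elim: N f => [|N IH] f lf.
  have [v fv] := lf [::] erefl; exists (value v) => w /size0nil ->; by exists v.
have /choice[y yP] a : exists y, evaluates N (f \o scons a) y.
  by apply: IH; exact: local_scons.
exists (jj t y) => -[//|a w] [sw]; have [v [fv dv]] := yP a w sw.
by exists v; split=> [z|]; [rewrite app_cons -fv|rewrite /descend /= jjE].
Qed.

Lemma evaluates_le N M f y : evaluates N f y -> N <= M -> evaluates M f y.
Proof.
move=> ey NM w sw; have [|v [fv dv]] := ey (take N w); first by rewrite size_takel ?sw.
exists (xact v (drop N w)); split=> [z|].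
  by rewrite -{1}(cat_take_drop N w) app_cat fv ev_act.
by rewrite value_xact -dv /descend -foldl_cat cat_take_drop.
Qed.

Lemma evaluates_uniq N M f y y' : evaluates N f y -> evaluates M f y' -> y = y'.
Proof.
move=> /evaluates_le/(_ (leq_maxl N M)) e /evaluates_le/(_ (leq_maxr N M)) e'.
apply: (@descend_inj (maxn N M)) => w sw.
have [[v [fv ->]] [v' [fv' ->]]] := (e w sw, e' w sw).
by congr value; apply: (ev_sep n2) => z; rewrite -fv fv'.
Qed.

End Universal.

(** At depth 0 an element is a component of a generator along a finite word, and each further level
    is one joining of n elements. This yields the uniqueness half of freeness. *)
Lemma jt_free_ind (T : jt_free -> Prop) :
  (forall i, T (jt_gen i)) -> (forall x a, T x -> T (jsp jt_free_algebra x a)) ->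
  (forall x, (forall a, T (jsp jt_free_algebra x a)) -> T x) -> forall x, T x.
Proof.
move=> Tg Ts Tj [f lf]; have [N lfN] := lf; elim: N f lf lfN => [|N IH] f lf lfN.
  have [v fv] := lfN [::] erefl.
  have E : foldl (jsp jt_free_algebra) (jt_gen v.1) v.2 = exist _ f lf :> jt_free.
    have H w x : sval (foldl (jsp jt_free_algebra) x w) = sval x \o app w.
      elim: w x => [|a w IHw] x /=; first by apply/funext => z; rewrite /= app0.
      by rewrite IHw; apply/funext => z; rewrite /= app_cons.
    apply: jt_free_eq; rewrite H; apply/funext => z.
    by rewrite [RHS]/= -[in RHS](app0 z) fv.
  rewrite -E; elim/last_ind: v.2 {E fv} => [|w a IHw]; first exact: Tg.
  by rewrite foldl_rcons; exact: Ts.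
by apply: Tj => a; apply: IH; exact: local_scons.
Qed.

Lemma jt_freeP : @free (jt_theory 'I_n) _ jt_free_algebra r jt_gen.
Proof.
move=> Z t s.
have /choice[h hP] (x : jt_free) : exists y, exists N, evaluates t s N (sval x) y.
  by case: x => f [N lf]; have [y ey] := evaluates_ex t s lf; exists y, N.
have hh : @hom (jt_theory 'I_n) _ _ jt_free_algebra t h.
  move=> x a; have [[N e] [M e']] := (hP x, hP (jsp jt_free_algebra x a)).
  apply: (evaluates_uniq e' (M := N)) => w sw.
  have [|v [fv dv]] := evaluates_le e (leqnSn N) (w := a :: w); first by rewrite /= sw.
  by exists v; split=> // z; rewrite -fv app_cons.
have he i : h (jt_gen i) = s i.
  have [N e] := hP (jt_gen i); apply: (evaluates_uniq e (M := 0)) => w /size0nil ->.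
  by exists (i, [::]); split=> // z; rewrite /ev !app0.
exists h; split=> // h' hh' h'e; apply/funext; apply: jt_free_ind => [i|x a e|x e]; first by rewrite h'e he.
  by rewrite hh' hh e.
by apply: (@j_ext _ _ t) => a; rewrite -hh' -hh e.
Qed.

End FreeAlgebra.

(** * Higman-Thompson groups as automorphism groups *)

Section AutFree.
Variables (n r : nat) (n2 : 2 <= n) (r1 : 1 <= r).
Local Notation G := (higman_thompson n2 r1).
Local Notation F := (jt_free n r).

Lemma local_pw (h : point n r -> point n r) (f : iword n -> point n r) : pw h ->
  (exists N, local_at N f) -> exists N, local_at N (h \o f).
Proof.
move=> [M hM] [N lf]; exists (N + M) => w sw.
have [|v fv] := lf (take N w); first by rewrite size_takel ?sw ?leq_addr.
have [|v' hv] := pw_atP n2 hM (u := xact v (drop N w)).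
  by rewrite size_cat size_drop sw addKn leq_addl.
by exists v' => z; rewrite -{1}(cat_take_drop N w) app_cat /= fv -ev_act hv.
Qed.

Definition post (h : point n r -> point n r) (ph : pw h) (x : F) : F :=
  exist _ (h \o sval x) (local_pw ph (svalP x)).

Lemma post_hom h (ph : pw h) :
  @hom (jt_theory 'I_n) _ _ (jt_free_algebra n r) (jt_free_algebra n r) (post ph).
Proof. by move=> x a; exact: jt_free_eq. Qed.

Definition on_gens (u : F -> F) (x : point n r) : point n r :=
  sval (u (jt_gen n x.1)) x.2.

Lemma on_gens_pw u : pw (on_gens u).
Proof.
have /choice[N lN] i : exists N, local_at N (sval (u (jt_gen n i))) by case: (u _).
exists (\max_i N i) => x; have [|v fv] := local_atS (lN x.1) (leq_bigmax x.1) (w := (pref (\max_i N i) x).2).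
  by rewrite size_pref.
by exists (pref (\max_i N i) x), v; split=> //; rewrite size_pref.
Qed.

(** By freeness [u] is determined by its values on generators, and composition with [on_gens u] has
    the same values there. Automorphisms thus come from bijections of points. *)
Lemma on_gensE u : @hom (jt_theory 'I_n) _ _ (jt_free_algebra n r) (jt_free_algebra n r) u ->
  forall x, sval (u x) = on_gens u \o sval x.
Proof.
move=> hu x.
have [h [_ _ uh]] := jt_freeP n2 (jt_free_algebra n r) (fun i => u (jt_gen n i)).
have E : u = post (on_gens_pw u).
  transitivity h; first exact: uh.
  symmetry; apply: uh; first exact: post_hom.
  by move=> i; apply: jt_free_eq; apply/funext => z.
by rewrite {1}E.
Qed.

Lemma aut_rep_jt_free :
  @aut_rep G (jt_theory 'I_n) F (jt_free_algebra n r).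
Proof.
exists (fun g => post (rho_pw g)); split.
- by move=> g h y; apply: jt_free_eq; apply/funext => z; exact: rhoM.
- by move=> y; apply: jt_free_eq; apply/funext => z; exact: rho1.
- by move=> g; exact: post_hom.
- move=> g h e; apply: rho_inj => -[i z].
  by have /(congr1 sval)/funeqP/(_ z) := e (jt_gen n i).
- move=> u u' uK u'K hu hu'.
  have K v v' : cancel v v' -> @hom (jt_theory 'I_n) _ _ (jt_free_algebra n r) (jt_free_algebra n r) v' ->
      cancel (on_gens v) (on_gens v').
    move=> vK hv' [i z]; have /funeqP/(_ z) := on_gensE hv' (v (jt_gen n i)).
    by rewrite vK.
  have [g eg] := rho_surj n2 r1 (K _ _ uK hu') (K _ _ u'K hu) (on_gens_pw u) (on_gens_pw u').
  exists g; apply/funext => x; apply: jt_free_eq.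
  by rewrite [RHS](on_gensE hu) -eg.
Qed.

Lemma aut_rep_free Y (s : jt 'I_n Y) (e : 'I_r -> Y) :
  @free (jt_theory 'I_n) Y s r e -> @aut_rep G (jt_theory 'I_n) Y s.
Proof.
move=> fs; have [j [j' [jK j'K hj hj']]] := free_iso (jt_freeP n2 (r := r)) fs.
exact: (@aut_rep_conj _ (jt_theory 'I_n) _ _ _ _ _ _ jK j'K hj hj' aut_rep_jt_free).
Qed.

End AutFree.

(** The generator [e ord0] is exchanged for its n components, from which it is recovered by
    joining. *)
Lemma free_more_gens n Y (s : jt 'I_n Y) r (e : 'I_r.+1 -> Y) :
  @free (jt_theory 'I_n) Y s r.+1 e ->
  exists e', @free (jt_theory 'I_n) Y s (r + n) e'.
Proof.
move=> fs; pose e' (i : 'I_(r + n)) :=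
  match fintype.split i with inl i => e (lift ord0 i) | inr a => jsp s (e ord0) a end.
have e'l i : e' (lshift n i) = e (lift ord0 i).
  by rewrite /e' -/(unsplit (inl i)) unsplitK.
have e'r a : e' (rshift r a) = jsp s (e ord0) a.
  by rewrite /e' -/(unsplit (inr a)) unsplitK.
exists e' => Z t f.
pose f0 (i : 'I_r.+1) := if unlift ord0 i is Some j then f (lshift n j)
  else jj t (fun a => f (rshift r a)).
have [h [hh he uh]] := fs Z t f0; exists h; split=> // [i|h' hh' h'e].
  rewrite -(splitK i); case: (fintype.split i) => [j|a] /=.
    by rewrite e'l he /f0 liftK.
  by rewrite e'r hh he /f0 unlift_none jjE.
apply: uh => // i; rewrite /f0; case: unliftP => [j|] ->.
  by rewrite -e'l h'e.
by apply: (@j_ext _ _ t) => a; rewrite -hh' -e'r h'e jjE.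
Qed.

(** * Powers of Jonsson-Tarski algebras *)

Definition of_ord0 T (i : 'I_0) : T :=
  False_rect T (Bool.diff_false_true (ltn_ord i)).

Section Power.
Variables (n d : nat) (Y : Type) (s : jt 'I_n Y).

Definition power_str : str2 'I_n 'I_0 'I_d 'I_0 ('I_d -> Y).
Proof.
refine (@Str2 'I_n 'I_0 'I_d 'I_0 ('I_d -> Y) Y (jsp s) (fun _ => @of_ord0 _)
  (fun u _ => jj s u) (fun y => y) (fun _ => @of_ord0 _) (fun u _ => u) _ _ _ _ _ _) => //.
- by move=> u v a; rewrite jjE.
- by move=> u v [].
- by move=> x x' ea _; exact: j_ext ea.
- by move=> u v [].
- by move=> y y' e _; apply/funext.
Defined.

Lemma power_homP h : hom2 power_str power_str h <->
  exists2 k, homj s s k & h = fun y i => k (y i).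
Proof.
split=> [[k [k1 _ k3 _]]|[k hk ->]]; exists k => //.
  by apply/funext => y; apply/funext => i; exact/esym/(k3 y i).
by split=> // [x []|y []].
Qed.

(** Sending [r] generators to elements of X^d amounts to choosing [d * r] elements of the hidden
    algebra X, and the homomorphism on the hidden sort determines the one on the power. *)
Lemma free_power r (e : 'I_(d * r) -> Y) : @free (jt_theory 'I_n) Y s (d * r) e ->
  exists e', @free (ord_theory n 0 d 0) _ power_str r e'.
Proof.
move=> fs; have [|b [b' bK b'K]] := @card_eq_bij ('I_d * 'I_r)%type 'I_(d * r).
  by rewrite !card_finE.
exists (fun j i => e (b (i, j))) => Z t f.
have tj : {tx : jt 'I_n (sX t) | jsp tx = xa (s := t)}.
  unshelve eexists.
    refine (@JT 'I_n (sX t) (xa (s := t)) (fun u => xj (s := t) u (@of_ord0 _)) _ _).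
      by move=> u a; rewrite xjA.
    by move=> y y' ea; apply: x_ext => // -[].
  by [].
case: tj => tx txE.
have [k [hk ke uk]] := fs _ tx (fun c => yb t (f (b' c).2) (b' c).1).
pose h (y : 'I_d -> Y) : Z := yj (s := t) (fun i => k (y i)) (@of_ord0 _).
exists h; split.
- exists k; split=> [x a|x []//|y i|y []//]; first by rewrite -txE -hk.
  by rewrite /h yjB.
- move=> i; apply: (@y_ext _ _ _ _ _ t) => [j|[]//].
  by rewrite /h yjB ke bK.
- move=> h' [k' [k1 _ k3 _]] h'e.
  have E : k' = k.
    apply: uk => [x a|c]; first by rewrite txE -k1.
    by rewrite -h'e -k3 /= -surjective_pairing b'K.
  apply/funext => y; apply: (@y_ext _ _ _ _ _ t) => [j|[]//].
  by rewrite -k3 E /h yjB.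
Qed.

Lemma aut_rep_power (G : groupType) : 0 < d -> @aut_rep G (jt_theory 'I_n) Y s ->
  @aut_rep G (ord_theory n 0 d 0) _ power_str.
Proof.
move=> d0 [a [aM a1 ah ai as_]]; pose i0 := Ordinal d0.
exists (fun g y i => a g (y i)); split.
- by move=> g h y; apply/funext => i; rewrite aM.
- by move=> y; apply/funext => i; rewrite a1.
- by move=> g; apply/power_homP; exists (a g) => //; exact: ah.
- by move=> g h e; apply: ai => y; have /funeqP/(_ i0) := e (fun=> y).
- move=> u u' uK u'K /power_homP[k hk eu] /power_homP[k' hk' eu']; subst u u'.
  have [||g eg] := as_ k k' _ _ hk hk'.
  + by move=> y; have /funeqP/(_ i0) := uK (fun=> y).
  + by move=> y; have /funeqP/(_ i0) := u'K (fun=> y).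
  by exists g; rewrite eg.
Qed.

End Power.

(** * Group isomorphisms and derived groups *)

Lemma group_isomorphic_sym (G H : groupType) :
  group_isomorphic G H -> group_isomorphic H G.
Proof.
move=> [f [g fK gK]]; have gM := can2_gmulfM fK gK.
pose gm : {multiplicative H -> G} := HB.pack g (isMultiplicative.Build _ _ g gM).
by exists gm, f.
Qed.

Lemma group_isomorphic_trans (G H K : groupType) :
  group_isomorphic G H -> group_isomorphic H K -> group_isomorphic G K.
Proof.
move=> [f bf] [g bg].
have hM : {morph g \o f : x y / (x * y)%g} by move=> x y; rewrite /= !gmulfM.
pose hm : {multiplicative G -> K} := HB.pack (g \o f) (isMultiplicative.Build _ _ (g \o f) hM).
by exists hm; exact: bij_comp bg bf.
Qed.

Lemma group_isomorphic_refl (G : groupType) : group_isomorphic G G.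
Proof.
have hM : {morph @id G : x y / (x * y)%g} by [].
pose hm : {multiplicative G -> G} := HB.pack (@id G) (isMultiplicative.Build _ _ (@id G) hM).
by exists hm, id.
Qed.

Lemma derived_pred_iso (G H : groupType) (f : {multiplicative G -> H}) (g : H -> G) x :
  cancel f g -> cancel g f -> derived_pred x -> derived_pred (f x).
Proof.
move=> fK gK /asboolP dx; apply/asboolP => S [S1 SV] Sc.
have f1 : f 1%g = 1%g by apply: (@mulgI _ (f 1%g)); rewrite -gmulfM !mulg1.
have fV y : f y^-1%g = (f y)^-1%g.
  by apply: (@mulgI _ (f y)); rewrite mulgV -gmulfM mulgV f1.
have := dx [pred y | f y \in S]; rewrite inE; apply.
  split; first by rewrite inE f1.
  by move=> y z; rewrite !inE => Sy Sz; rewrite gmulfM fV; exact: SV.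
by move=> a b; rewrite inE /commg /conjg !gmulfM !fV; exact: Sc.
Qed.

Lemma derived_isomorphic (G H : groupType) :
  group_isomorphic G H -> group_isomorphic (derived G) (derived H).
Proof.
move=> [f [g fK gK]]; have gM := can2_gmulfM fK gK.
pose gm : {multiplicative H -> G} := HB.pack g (isMultiplicative.Build _ _ g gM).
pose F (x : derived G) : derived H := Sub (f (val x)) (derived_pred_iso fK gK (valP x)).
pose F' (x : derived H) : derived G :=
  Sub (gm (val x)) (derived_pred_iso (f := gm) gK fK (valP x)).
have FM : {morph F : x y / (x * y)%g}.
  by move=> x y; apply: val_inj; rewrite gmulfM !SubK !gmulfM.
pose Fm : {multiplicative derived G -> derived H} := HB.pack F (isMultiplicative.Build _ _ F FM).
exists Fm, F' => x; apply: val_inj; rewrite /= ?SubK /=; [exact: fK|exact: gK].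
Qed.

(** * Isomorphisms between groups with the same n *)

Section Sufficiency.
Variables (n : nat) (n2 : 2 <= n).

Definition iso_rank r r' : Prop := forall (r1 : 1 <= r) (r1' : 1 <= r'),
  group_isomorphic (higman_thompson n2 r1) (higman_thompson n2 r1').

Lemma iso_rank_shift r : iso_rank r (r + n.-1).
Proof.
case: r => // r r1.
have -> : r.+1 + n.-1 = r + n by lia.
move=> r1'; have [e fe] := free_more_gens (jt_freeP n2 (r := r.+1)).
exact: aut_rep_iso (aut_rep_jt_free n2 r1) (aut_rep_free n2 r1' fe).
Qed.

Lemma iso_rank_mul d r : 0 < d -> d < n.-1 -> coprime d n.-1 -> iso_rank (d * r) r.
Proof.
move=> d0 dn co dr1 r1.
have [R [lt rt RP]] := power_theory_jt d0 dn co.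
have [e' fe'] := free_power (jt_freeP n2 (r := d * r)).
(* The power carries a Jonsson-Tarski structure [t] with the same homomorphisms. Any test algebra on
   [Z] can also be seen as a power structure, so freeness on [r] generators passes to [t]. *)
have [t Rt] := lt _ (power_str d (jt_free_algebra n (d * r))).
have ft : @free (jt_theory 'I_n) _ t r e'.
  move=> Z u f; have [v Rv] := rt Z u.
  have [h [hh he uh]] := fe' Z v f; exists h; split=> //.
    exact/(RP _ _ _ _ _ _ _ Rt Rv).
  by move=> h' /(RP _ _ _ _ _ _ _ Rt Rv); exact: uh.
apply: (@aut_rep_iso _ _ (jt_theory 'I_n) _ t); last exact: aut_rep_free ft.
apply: (@aut_rep_interdef _ (ord_theory n 0 d 0) (jt_theory 'I_n) _ (power_str d (jt_free_algebra n (d * r)))).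
  by move=> h; exact: RP.
exact/aut_rep_power/aut_rep_jt_free.
Qed.

Lemma iso_rank_shifts k r : iso_rank r (r + k * n.-1).
Proof.
elim: k => [|k IH] r1 r1'.
  move: r1'; rewrite mul0n addn0 => r1'.
  by rewrite (bool_irrelevance r1 r1'); exact: group_isomorphic_refl.
have r2 : 1 <= r + k * n.-1 by rewrite ltn_addr.
apply: group_isomorphic_trans (IH r1 r2) _.
by move: r1'; rewrite mulSn addnCA addnC => r1'; exact: iso_rank_shift.
Qed.

Lemma iso_rank_mod r r' : r = r' %[mod n.-1] -> iso_rank r r'.
Proof.
have H a b : a <= b -> b = a %[mod n.-1] -> iso_rank a b.
  move=> ab /eqP; rewrite eqn_mod_dvd // => /dvdnP[k e].
  have -> : b = a + k * n.-1 by rewrite -e subnKC.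
  exact: iso_rank_shifts.
case: (leqP r r') => h e r1 r1'; first exact: H.
by apply: group_isomorphic_sym; apply: H => //; exact: ltnW.
Qed.

(** This reduces a rank to its greatest common divisor with N, up to a unit modulo N that can serve
    as the exponent of a power. *)
Lemma unit_multiple N r : 1 < N -> 0 < r ->
  exists u, [/\ 0 < u, u < N, coprime u N & r = u * gcdn N r %[mod N]].
Proof.
move=> N1 r0; set t := gcdn N r; have N0 : 0 < N by exact: ltnW.
have t0 : 0 < t by rewrite gcdn_gt0 N0.
have [eN er] : N = N %/ t * t /\ r = r %/ t * t.
  by rewrite !divnK ?dvdn_gcdl ?dvdn_gcdr.
set N' := N %/ t in eN; set r' := r %/ t in er.
have r'0 : 0 < r' by move: r0; rewrite er; case: (r').
have co : coprime r' N'.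
  by rewrite coprime_sym /coprime -(eqn_pmul2r t0) muln_gcdl -eN -er mul1n.
(* The part of N prime to [r']. A prime of N dividing [r'] divides neither [k] nor [N'], and any
   other prime of N divides [k]; so no prime of N divides [r' + k * N']. *)
pose k := N`_(\pi(r')^').
pose u := r' + k * N'.
have cu : coprime u N.
  rewrite /coprime eqn_leq gcdn_gt0 N0 orbT andbT leqNgt; apply/negP => g1.
  have p_pr := pdiv_prime g1; set p := pdiv _ in p_pr.
  have [pu pN] : p %| u /\ p %| N.
    by split; apply: dvdn_trans (pdiv_dvd _) _; rewrite ?dvdn_gcdl ?dvdn_gcdr.
  have [pr|npr] := boolP (p %| r').
    have : p %| k * N' by rewrite -(dvdn_addr _ pr).
    rewrite Euclid_dvdM // => /orP[pk|pN'].
      have : p \in primes k by rewrite mem_primes p_pr part_gt0.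
      by rewrite primes_part mem_filter !inE /= mem_primes p_pr r'0 pr.
    have : p %| gcdn r' N' by rewrite dvdn_gcd pr.
    by rewrite (eqP co) Euclid_dvd1.
  have : p \in primes k.
    by rewrite primes_part mem_filter !inE /= !mem_primes p_pr r'0 N0 (negbTE npr).
  rewrite mem_primes => /and3P[_ _ pk]; move: npr.
  by rewrite -(dvdn_addl _ (dvdn_mulr N' pk)) -/u pu.
exists (u %% N); split.
- rewrite lt0n; apply/eqP => u0; move: cu; rewrite -coprime_modl u0 /coprime gcd0n.
  by move=> /eqP N1'; move: N1; rewrite N1'.
- by rewrite ltn_mod.
- by rewrite coprime_modl.
- by rewrite modnMml mulnDl -er -mulnA -eN addnC modnMDl.
Qed.

Lemma iso_rank_gcd r : 1 <= r -> iso_rank r (gcdn n.-1 r).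
Proof.
(* For n = 2 there is no exponent strictly between 0 and n-1, but all ranks are congruent modulo
   1. *)
move=> r0; have [N1|N1] := leqP n.-1 1.
  apply: iso_rank_mod; have -> : n.-1 = 1 by have := n2; lia.
  by rewrite !modn1.
have [u [u0 uN cu e]] := unit_multiple N1 r0.
move=> r1 g1; have ug : 1 <= u * gcdn n.-1 r by rewrite muln_gt0 u0.
apply: group_isomorphic_trans (iso_rank_mod e r1 ug) _.
exact: iso_rank_mul.
Qed.

Lemma iso_of_gcd r s (r1 : 1 <= r) (s1 : 1 <= s) : gcdn n.-1 r = gcdn n.-1 s ->
  group_isomorphic (higman_thompson n2 r1) (higman_thompson n2 s1).
Proof.
move=> e; have g1 : 1 <= gcdn n.-1 r by rewrite gcdn_gt0 r1 orbT.
apply: group_isomorphic_trans (iso_rank_gcd r1 r1 g1) _.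
apply: group_isomorphic_sym; move: g1; rewrite e => g1; exact: iso_rank_gcd.
Qed.

End Sufficiency.

Theorem theorem3p6 (m n r s : nat)
    (m_ge2 : 2 <= m) (n_ge2 : 2 <= n) (r_ge1 : 1 <= r) (s_ge1 : 1 <= s) :
  group_isomorphic (derived (higman_thompson m_ge2 r_ge1))
                   (derived (higman_thompson n_ge2 s_ge1)) <->
  m = n /\ gcdn (n - 1) r = gcdn (n - 1) s.
Proof.
split; first exact: derived_iso_invariants.
move=> [e]; subst m; rewrite subn1 (bool_irrelevance m_ge2 n_ge2) => e.
exact/derived_isomorphic/iso_of_gcd.
Qed.
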